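(* Let $n\ge 1$, $0<\lambda<\Lambda$, $T>0$, $K\ge0$, let $\Omega\subset\mathbb{R}^n$ be open and $\Omega_T=\Omega\times(0,T)$. Let $b=(b_1,\dots,b_n):\Omega_T\to\mathbb{R}^n$ and $c:\Omega_T\to\mathbb{R}$ satisfy $|b|\le K$ and $c\le 0$ in $\Omega_T$, and put $$\mathscr{L}u=-\frac{\partial u}{\partial t}+\mathcal{M}^+_{\lambda,\Lambda}(D^2u)+b(x,t)\cdot Du+c(x,t)u ,$$ $$\mathscr{M}_t=\mathcal{M}^+_{\lambda,\Lambda}(D^2(\cdot))+\sum_{i=1}^n b_i(\cdot,t)\frac{\partial}{\partial x_i}+c(\cdot,t),\qquad t\in(0,T).$$ Let $E\subset\partial\Omega$ and $z_0\in E$. Let $\mu>0$ and $\eta>0$. Suppose there exists a family of uniformly strong local (singular) barriers of order $-\mu$ for the family $\{\mathscr{M}_t\}_{t\in(0,T)}$ in $\Omega$ at $E$, and that there exists a strong local (regular) barrier of order $\eta$ for the same family $\{\mathscr{M}_t\}_{t\in(0,T)}$ in $\Omega$ at $z_0$. Suppose also that the Hausdorff dimension $\mathscr{H}(E)$ of $E$ satisfies $\mathscr{H}(E)<\mu$. Let $u\in C^{2,1}(\Omega_T)$, and suppose that for some constant $L\ge 0$, $$u(x,t)\ge -L,\qquad \mathscr{L}u(x,t)\le L\qquad\text{for all }(x,t)\in\Omega_T .$$ Let $0<t_0<T$. If $u\ge0$ on $(\partial\Omega\setminus E)\times(0,T)$ near $(z_0,t_0)$, then $u\ge 0$ at $(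z_0,t_0)$.
   Context: Pucci's extremal operator: for a symmetric $n\times n$ matrix $M$ with eigenvalues $e_1,\dots,e_n$, $\mathcal{M}^+_{\lambda,\Lambda}(M)=\Lambda\sum_{e_i>0}e_i+\lambda\sum_{e_i<0}e_i$. $Du$, $D^2u$ are the gradient and Hessian in $x$. $C^{2,1}(\Omega_T)$ means twice continuously differentiable in $x$ and once in $t$. Barriers: let $F\subset\partial\Omega$ and let $m$ be a real number. A family of functions $\{h_z\}_{z\in F}$, written $h(y,z):=h_z(y)$, is a family of uniformly strong local barriers of order $m$ for the family $\{\mathscr{M}_t\}_{t\in(0,T)}$ in $\Omega$ at $F$ if there are positive constants $r_0,C_1,C_2,C_3,C_4,C_5$ (independent of $z$) such that for each $z\in F$: (1) $h_z$ is defined and continuous on $\overline{\Omega}\cap\{x: 0<|x-z|<r_0\}$ and $C^2$ on $\Omega\cap\{x:0<|x-z|<r_0\}$; and for all $y\in\Omega$ with $0<|y-z|<r_0$: (2) $C_1|y-z|^{m}\le h(y,z)\le C_2|y-z|^{m}$; (3) $|D_ih(y,z)|\le C_3|y-z|^{m-1}$ for $i=1,\dots,n$; (4) $|D_{ij}h(y,z)|\le C_4|y-z|^{m-2}$ for $i,j=1,\dots,n$; (5) $\mathscr{M}_t h(y,z)\le -C_5|y-z|^{m-2}$ for all $t\in(0,T)$. Derivatives are in the variable $y$, and in $\mathscr{M}_t$ the coefficients are evaluated at $(y,t)$. The barrier is called singular if $m<0$ and regular if $m>0$. A strong local barrier of order $m$ at a single point $z_0$ is such a family with $F=\{z_0\}$.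 Boundary inequalities: for a boundary point $(x_0,t_0)$ of $\Omega_T$, ''$u\ge0$ at $(x_0,t_0)$'' means $\liminf u(x,t)\ge0$ as $(x,t)\to(x_0,t_0)$ from inside $\Omega_T$. For $\mathscr{D}\subset\partial\Omega_T$, ''$u\ge0$ on $\mathscr{D}$'' means $u\ge 0$ at every point of $\mathscr{D}$, and ''$u\ge0$ on $\mathscr{D}$ near $(z_0,t_0)$'' means $u\ge0$ on the intersection of $\mathscr{D}$ with some neighborhood of $(z_0,t_0)$ in $\mathbb{R}^{n+1}$. *)

(* Defs.v *)
From HB Require Import structures.
From mathcomp Require Export all_boot all_order all_algebra.
From mathcomp Require Export all_classical all_reals all_analysis.

Set Implicit Arguments.
Unset Strict Implicit.
Unset Printing Implicit Defensive.
Export Order.TTheory GRing.Theory Num.Theory.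
Export numFieldNormedType.Exports.

#[global] Open Scope classical_set_scope.
#[global] Open Scope ring_scope.

(* The library norm on 'rV[R]_n is the sup norm, hence a separate Euclidean
   norm; both induce the library topology of 'rV[R]_n. *)
Definition enorm (R : realType) n (v : 'rV[R]_n) : R :=
  Num.sqrt (\sum_i v 0 i ^+ 2).

Definition boundary (T : topologicalType) (A : set T) : set T :=
  closure A `\` interior A.

Section PucciOperator.
Variables (R : realType) (n : nat).

(* Eigenvalues listed with multiplicity: the list exists for symmetric M and
   is unique up to permutation. *)
Definition eigenvalues (M : 'M[R]_n) : seq R :=
  xget [::] [set s | char_poly M = \prod_(e <- s) ('X - e%:P)].

Definition pucci (lam Lam : R) (M : 'M[R]_n) : R :=
  Lam * (\sum_(e <- eigenvalues M | 0 < e) e) +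
  lam * (\sum_(e <- eigenvalues M | e < 0) e).

End PucciOperator.

(* The ambient space is 'rV[R]_n.+1, of dimension n + 1 >= 1: the library
   equips row vectors with a normed module structure only when their length
   is a successor. *)
Section DifferentialOperators.
Variables (R : realType) (n : nat).
Local Notation V := 'rV[R]_n.+1.

Definition partial (i : 'I_n.+1) (f : V -> R) : V -> R :=
  fun x => 'D_(delta_mx 0 i) f x.

Definition hessian (f : V -> R) (x : V) : 'M[R]_n.+1 :=
  \matrix_(i, j) partial j (partial i f) x.

(* {in U, continuous g} is continuity of g at each point of U, which for the
   open sets considered here is continuity of the restriction of g to U. *)
Definition C2_on (U : set V) (f : V -> R) : Prop :=
  [/\ {in U, continuous f},
      forall i, {in U, forall x, derivable f x (delta_mx 0 i)} /\
                {in U, continuous (partial i f)} &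
      forall i j, {in U, forall x, derivable (partial i f) x (delta_mx 0 j)} /\
                  {in U, continuous (partial j (partial i f))}].

Definition C21_on (Q : set (V * R)) (u : V -> R -> R) : Prop :=
  [/\ {in Q, continuous (fun p : V * R => u p.1 p.2)},
      forall i,
        {in Q, forall p, derivable (u^~ p.2) p.1 (delta_mx 0 i)} /\
        {in Q, continuous (fun p : V * R => partial i (u^~ p.2) p.1)},
      forall i j,
        {in Q, forall p,
          derivable (partial i (u^~ p.2)) p.1 (delta_mx 0 j)} /\
        {in Q, continuous
          (fun p : V * R => partial j (partial i (u^~ p.2)) p.1)} &
      {in Q, forall p, derivable (u p.1) p.2 1} /\
      {in Q, continuous (fun p : V * R => derive1 (u p.1) p.2)}].

Definition elliptic_op (lam Lam : R) (b : V -> R -> V) (c : V -> R -> R)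
    (t : R) (f : V -> R) (x : V) : R :=
  pucci lam Lam (hessian f x) + \sum_i b x t 0 i * partial i f x +
  c x t * f x.

Definition parabolic_op (lam Lam : R) (b : V -> R -> V) (c : V -> R -> R)
    (u : V -> R -> R) (x : V) (t : R) : R :=
  - derive1 (u x) t + elliptic_op lam Lam b c t (u^~ t) x.

Definition cylinder (Omega : set V) (T : R) : set (V * R) :=
  Omega `*` [set t | 0 < t < T].

Definition punctured_ball (z : V) (r : R) : set V :=
  [set x | 0 < enorm (x - z) < r].

(* h is a total function; only its values h z y with z in F and y in
   closure Omega, 0 < |y - z| < r0, are constrained. *)
Definition barrier_family (M : R -> (V -> R) -> V -> R) (T : R)
    (Omega F : set V) (m : R) (h : V -> V -> R) : Prop :=
  exists r0 C1 C2 C3 C4 C5 : R,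
    [/\ 0 < r0, 0 < C1, 0 < C2 & [/\ 0 < C3, 0 < C4 & 0 < C5]] /\
    forall z, F z ->
      [/\ {within closure Omega `&` punctured_ball z r0, continuous (h z)},
          C2_on (Omega `&` punctured_ball z r0) (h z) &
          forall y, Omega y -> punctured_ball z r0 y ->
            [/\ C1 * enorm (y - z) `^ m <= h z y <= C2 * enorm (y - z) `^ m,
                forall i, `|partial i (h z) y| <= C3 * enorm (y - z) `^ (m - 1),
                forall i j,
                  `|hessian (h z) y i j| <= C4 * enorm (y - z) `^ (m - 2) &
                forall t, 0 < t < T ->
                  M t (h z) y <= - C5 * enorm (y - z) `^ (m - 2)]].

(* "u >= 0 at p", for p a boundary point of Q: the liminf of u at p, taken
   from inside Q, is nonnegative. *)
Definition nonneg_at (Q : set (V * R)) (u : V -> R -> R) (p : V * R) : Prop :=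
  (0 <= limf_einf (fun q : V * R => (u q.1 q.2)%:E) (within Q (nbhs p)))%E.

Definition nonneg_on_near (Q D : set (V * R)) (u : V -> R -> R) (p : V * R) :
    Prop :=
  \forall q \near p, D q -> nonneg_at Q u q.

End DifferentialOperators.

Section HausdorffDimension.
Variables (R : realType) (n : nat).
Local Notation V := 'rV[R]_n.
Local Open Scope ereal_scope.

(* equal to -oo on the empty set *)
Definition diam (U : set V) : \bar R :=
  ereal_sup [set (enorm (p.1 - p.2))%:E | p in U `*` U].

(* diam(U)^s, with the convention that the empty set contributes 0, also when
   s = 0; for nonempty U, 0 `^ 0 = 1, so s = 0 yields the counting measure. *)
Definition diam_pow (s : R) (U : set V) : \bar R :=
  if U == set0 then 0 else poweR (diam U) s.

Definition hausdorff_premeasure (s delta : R) (E : set V) : \bar R :=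
  ereal_inf [set \sum_(0 <= k <oo) diam_pow s (U k) | U in
    [set U : nat -> set V | E `<=` \bigcup_k U k /\
                            forall k, diam (U k) <= delta%:E]].

Definition hausdorff_measure (s : R) (E : set V) : \bar R :=
  ereal_sup [set hausdorff_premeasure s delta E | delta in
    [set delta : R | (0 < delta)%R]].

Definition hausdorff_dim (E : set V) : \bar R :=
  ereal_inf [set s%:E | s in
    [set s : R | (0 <= s)%R /\ hausdorff_measure s E = 0]].

End HausdorffDimension.

(* Main.v *)
Require Import Defs.
From mathcomp Require Import complex.
From mathcomp Require Import ring lra.

Set Implicit Arguments.
Unset Strict Implicit.
Unset Printing Implicit Defensive.

(** Why the theorem holds.

    Everything is reduced to a linear operator.  For symmetric X the
    difference between M^+(X) and lam * tr X is (Lam - lam) times the sum of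
    the positive eigenvalues of X ([pucci_ge_trace]); hence
    M_t f >= lam * Laplacian f + b . Df + c f =: P_t f for every C^2
    function f ([laplace_le_elliptic]).  The upper bounds on L u and on
    M_t h for the barriers h are therefore upper bounds on P_t, which is
    additive, so that u and any nonnegative combination of barriers can be
    added without appealing to the subadditivity of M^+.  At a spatial
    minimum where the function is nonpositive, P_t of it is nonnegative
    ([laplace_op_min]).

    Let h_0 be the regular barrier at z_0, of order eta, and th = 1/(1+eta).
    The function W = A h_0^th satisfies P_t W <= -M, in the sense of functions
    touching it from above and with M as large as desired, even when eta > 2:
    the exponent eta * th is below 1, so the bound -C |x - z_0|^(eta th - 2) on
    P_t W does not degenerate at z_0.  Since a concave power lies below its
    tangent line, W is touched from above at each point by a multiple of h_0
    plus a constant, and only h_0 has to be differentiated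
    ([regular_majorant]).

    Because the Hausdorff dimension of E is below mu, the part of E near z_0
    is covered by balls B(z_k, r_k) with z_k in E and sum of r_k^mu as small as
    desired ([ball_cover]).  The sum S of r_k^mu h(., z_k) over finitely many
    k has P_t S <= 0, is bounded below by a fixed constant on each of these
    balls, and at a given point of Omega is at most a constant times the sum
    of r_k^mu ([singular_majorant]).

    On a small cylinder around (z_0, t_0), compare u with -v, where
    v = W + k S + beta (t - t_0)^2 + eps.  Near the bottom, near the lateral
    sphere and near the points of E the respective terms of v outweigh the
    bound u >= -L; near the other lateral points u >= -eps by hypothesis.
    Compactness makes finitely many balls sufficient ([compact_finite_balls]).
    So u + v cannot be negative, as it would have a negative interior minimum
    ([comparison]).  With the point (x, t) fixed, eps and the sum of r_k^mu
    tend to 0, so S disappears and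
    u(x,t) >= - W(x) - beta (t - t_0)^2
    ([lower_bound_by_regular_majorant]); the right-hand side tends to 0 at
    (z_0, t_0). *)

(** * Eigenvalues and the trace bound for the Pucci operator *)

Lemma char_poly_conj (F : fieldType) n (P D : 'M[F]_n) :
  P \in unitmx -> char_poly (invmx P *m D *m P) = char_poly D.
Proof.
move=> Pu.
have PVP : map_mx polyC (invmx P) *m map_mx polyC P = 1%:M.
  by rewrite -map_mxM mulVmx// map_mx1.
have eqP : char_poly_mx (invmx P *m D *m P) =
    map_mx polyC (invmx P) *m char_poly_mx D *m map_mx polyC P.
  rewrite /char_poly_mx mulmxBr mulmxBl !map_mxM; congr (_ - _).
  by rewrite -mulmxA -scalar_mxC mulmxA PVP mul1mx.
rewrite /char_poly eqP !det_mulmx mulrAC -det_mulmx PVP det1 mul1r.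
by [].
Qed.

(** Over R[i] the matrix is Hermitian, hence unitarily diagonalizable with real
    eigenvalues; the factorization of the characteristic polynomial descends
    to R because the embedding of R in R[i] is injective on polynomials. *)
Lemma char_poly_symmetric_split (R : rcfType) n (M : 'M[R]_n) :
  M^T = M -> exists s, char_poly M = \prod_(e <- s) ('X - e%:P).
Proof.
move=> Msym; pose toC := complex.real_complex R.
pose MC := map_mx toC M.
have MCh : MC \is hermsymmx.
  apply/is_hermitianmxP; rewrite expr0 scale1r.
  apply/matrixP => i j; rewrite !mxE.
  have /matrixP/(_ i j) := Msym; rewrite mxE => ->.
  by rewrite (CrealP _)//; apply/complex.complex_realP; exists (M i j).
have /mxOverP Dreal := hermitian_spectral_diag_real MCh.
have /hermitian_normalmx/orthomx_spectralP MCE := MCh.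
pose d := spectral_diag MC.
exists [seq complex.Re (d 0 i) | i <- enum 'I_n].
apply: (map_poly_inj toC).
rewrite map_char_poly -/MC MCE char_poly_conj ?spectral_unit//.
rewrite char_poly_trig ?diag_mx_is_trig// rmorph_prod big_map big_enum /=.
apply: eq_bigr => i _; rewrite rmorphB /= map_polyX map_polyC /=.
by rewrite mxE eqxx mulr1n /toC complex.RRe_real// Dreal.
Qed.

(** The trace is the sum of the eigenvalues, and replacing Lam by lam can only
    decrease the contribution of the positive ones. *)
Lemma pucci_ge_trace (R : realType) n (lam Lam : R) (M : 'M[R]_n.+1) :
  lam <= Lam -> M^T = M -> lam * \tr M <= pucci lam Lam M.
Proof.
move=> lL Msym.
have charE : char_poly M = \prod_(e <- eigenvalues M) ('X - e%:P).
  have [s sP] := char_poly_symmetric_split Msym.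
  exact: (xgetI [::] (sP : [set s | char_poly M = _] s)).
have sizeE : size (eigenvalues M) = n.+1.
  have := size_char_poly M; rewrite charE size_prod_XsubC.
  by case.
have trE : \tr M = \sum_(e <- eigenvalues M) e.
  apply: oppr_inj; rewrite -char_poly_trace// charE.
  by rewrite -coefPn_prod_XsubC sizeE.
rewrite trE (bigID (fun e => 0 < e))/= mulrDr lerD//.
  by rewrite ler_wpM2r// sumr_ge0// => e /ltW.
rewrite (bigID (fun e => e < 0))/= addrC big1 ?add0r; last first.
  by move=> e; rewrite -!leNgt => /le_anti.
rewrite (eq_bigl (fun e => e < 0))// => e /=.
by case: ltgtP.
Qed.

(** * Second derivatives along lines *)

Lemma continuous_dist_le (R : realType) (T : topologicalType) (g : T -> R)
    (x : T) (e : R) :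
  {for x, continuous g} -> 0 < e -> \forall y \near x, `|g x - g y| <= e.
Proof. by move=> /cvgrPdist_le gx e0; exact: gx. Qed.

Lemma mixed_quotients_close (R : realFieldType) (s e A B C D p q p0 q0 : R) :
  0 < s -> A - B - (C - D) = p * s * s -> A - C - (B - D) = q * s * s ->
  `|p0 - p| <= e / 2 -> `|q0 - q| <= e / 2 -> `|p0 - q0| <= e.
Proof.
move=> s0 E1 E2 B1 B2.
have pq : p * (s * s) = q * (s * s) by rewrite !mulrA -E1 -E2; ring.
have {}pq : p = q by apply: (mulIf _ pq); rewrite mulf_neq0// gt_eqF.
by move: B1 B2; rewrite pq !ler_norml => /andP[? ?] /andP[? ?]; lra.
Qed.

Lemma near_quotient_lt0 (R : realFieldType) (g : R -> R) (l : R) :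
  is_derive (0 : R) (1 : R) g l -> g 0 = 0 -> l < 0 ->
  \forall h \near (0 : R)^', h^-1 * g h < 0.
Proof.
move=> [dg dgl] g0 l0.
have ql : (fun h => h^-1 *: (g (h *: 1 + 0) - g 0)) @ (0 : R)^' --> l.
  by rewrite -dgl; exact: dg.
have : \forall h \near (0 : R)^', h^-1 *: (g (h *: 1 + 0) - g 0) < 0.
  exact: cvgr_lt ql 0 l0.
apply: filterS => h.
by rewrite g0 subr0 [h *: 1]mulr1 addr0.
Qed.

Section Lines.
Context {R : realType} {V : normedModType R}.
Implicit Types (f : V -> R) (x v w : V).

Lemma is_derive_line f x v (s : R) : derivable f (x + s *: v) v ->
  is_derive s 1 (fun s => f (x + s *: v)) ('D_v f (x + s *: v)).
Proof.
have E : (fun h : R => h^-1 *: (f (h *: v + (x + s *: v)) - f (x + s *: v))) =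
   (fun h : R => h^-1 *: (f (x + (h *: 1 + s) *: v) - f (x + s *: v))).
  by apply/funext => h; rewrite [h *: 1]mulr1 scalerDl addrCA.
move=> df; apply: DeriveDef; first by move: df; rewrite /derivable E.
by rewrite /derive E.
Qed.

Lemma nbhs_line (U : set V) x v : nbhs x U ->
  \forall s \near (0 : R), U (x + s *: v).
Proof.
move=> Ux.
have : (fun s : R => x + s *: v) @ (0 : R) --> x + 0 *: v.
  by apply: cvgD; [exact: cvg_cst | apply: cvgZr_tmp; exact: cvg_id].
by rewrite scale0r addr0; apply.
Qed.

(** The mean value theorem applied twice: to the increment of f in direction
    w as a function of the displacement along v, then to 'D_v f along w. *)
Lemma double_difference f x v w (s : R) : 0 < s ->
  (forall a b : R, 0 <= a <= s -> 0 <= b <= s ->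
     derivable f (x + a *: v + b *: w) v /\
     derivable ('D_v f) (x + a *: v + b *: w) w) ->
  exists a b : R, [/\ 0 <= a <= s, 0 <= b <= s &
    f (x + s *: v + s *: w) - f (x + s *: v) - (f (x + s *: w) - f x) =
      'D_w ('D_v f) (x + a *: v + b *: w) * s * s].
Proof.
move=> s0 df.
pose phi (a : R) := f (x + s *: w + a *: v) - f (x + a *: v).
have dphi (a : R) : 0 <= a <= s -> is_derive a (1:R) phi
    ('D_v f (x + a *: v + s *: w) - 'D_v f (x + a *: v)).
  move=> as'; apply: is_deriveB.
    have := @is_derive_line f (x + s *: w) v a.
    rewrite addrAC; apply.
    by apply: (df a s _ _).1; rewrite // lexx ltW.
  apply: is_derive_line.
  by have := (df a 0 as' _).1; rewrite scale0r addr0; apply; rewrite lexx ltW.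
have [a] : exists2 a, a \in `[0, s]%R & phi s - phi 0 =
   ('D_v f (x + a *: v + s *: w) - 'D_v f (x + a *: v)) * (s - 0).
  apply: (MVT_segment (df := fun a =>
    'D_v f (x + a *: v + s *: w) - 'D_v f (x + a *: v))); first exact: ltW.
    move=> y; rewrite in_itv /= => /andP[y0 ys]; apply: dphi.
    by rewrite !ltW.
  apply: derivable_within_continuous => y; rewrite in_itv /= => ys.
  by have [] := dphi _ ys.
rewrite in_itv /= subr0 => as' phiE.
pose psi (b : R) := 'D_v f (x + a *: v + b *: w).
have dpsi (b : R) : 0 <= b <= s -> is_derive b (1:R) psi
    ('D_w ('D_v f) (x + a *: v + b *: w)).
  by move=> bs; apply: is_derive_line; exact: (df a b as' bs).2.
have [b] : exists2 b, b \in `[0, s]%R & psi s - psi 0 =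
   'D_w ('D_v f) (x + a *: v + b *: w) * (s - 0).
  apply: (MVT_segment (df := fun b =>
    'D_w ('D_v f) (x + a *: v + b *: w))); first exact: ltW.
    move=> y; rewrite in_itv /= => /andP[y0 ys]; apply: dpsi.
    by rewrite !ltW.
  apply: derivable_within_continuous => y; rewrite in_itv /= => ys.
  by have [] := dpsi _ ys.
rewrite in_itv /= subr0 /psi scale0r addr0 => bs psiE.
exists a, b; split => //.
rewrite -psiE -phiE /phi scale0r !addr0 [x + s *: w + _]addrAC; ring.
Qed.

(** Schwarz: the second difference is symmetric in v and w, so it equals s^2
    times a value near x of either mixed derivative, and both are continuous
    at x. *)
Lemma derive_swap f (U : set V) x v w : nbhs x U ->
  (forall y, U y -> derivable f y v) -> (forall y, U y -> derivable f y w) ->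
  (forall y, U y -> derivable ('D_v f) y w) ->
  (forall y, U y -> derivable ('D_w f) y v) ->
  {for x, continuous ('D_w ('D_v f))} -> {for x, continuous ('D_v ('D_w f))} ->
  'D_w ('D_v f) x = 'D_v ('D_w f) x.
Proof.
move=> Ux dv dw dvw dwv cvw cwv.
apply/eqP; rewrite -subr_eq0 -normr_le0; apply/ler_addgt0Pr => /= e e0.
rewrite add0r.
have e2 : 0 < e / 2 by rewrite divr_gt0.
pose W := [set y | `|'D_w ('D_v f) x - 'D_w ('D_v f) y| <= e / 2] `&`
          [set y | `|'D_v ('D_w f) x - 'D_v ('D_w f) y| <= e / 2].
have nW : nbhs x W.
  by apply: filterI; [exact: continuous_dist_le cvw e2|
                      exact: continuous_dist_le cwv e2].
have /nbhs_ballP[d /= d0 dP] : nbhs x (U `&` W) by exact: filterI.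
pose M := `|v| + `|w| + 1.
have M0 : 0 < M by rewrite /M ltr_wpDl// addr_ge0.
pose s := d / 2 / M.
have s0 : 0 < s by rewrite /s !divr_gt0.
have near_par a b : 0 <= a <= s -> 0 <= b <= s ->
    ball x d (x + a *: v + b *: w).
  move=> /andP[a0 as'] /andP[b0 bs].
  rewrite -ball_normE /ball_ /= -addrA opprD addNKr normrN.
  rewrite (le_lt_trans (ler_normD _ _))// !normrZ !ger0_norm//.
  rewrite (@le_lt_trans _ _ (s * M))//; last first.
    by rewrite /s divfK ?gt_eqF//; lra.
  have := ler_wpM2r (normr_ge0 v) as'; have := ler_wpM2r (normr_ge0 w) bs.
  by rewrite /M; lra.
have mem_par a b : 0 <= a <= s -> 0 <= b <= s -> U (x + a *: v + b *: w).
  by move=> as' bs; have [] := dP _ (near_par a b as' bs).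
have [a [b [as' bs E1]]] : exists a b : R, [/\ 0 <= a <= s, 0 <= b <= s &
    f (x + s *: v + s *: w) - f (x + s *: v) - (f (x + s *: w) - f x) =
      'D_w ('D_v f) (x + a *: v + b *: w) * s * s].
  apply: (double_difference s0) => a b as' bs.
  by split; [apply: dv|apply: dvw]; exact: mem_par.
have [b' [a' [bs' as2 E2]]] : exists b a : R, [/\ 0 <= b <= s, 0 <= a <= s &
    f (x + s *: w + s *: v) - f (x + s *: w) - (f (x + s *: v) - f x) =
      'D_v ('D_w f) (x + b *: w + a *: v) * s * s].
  apply: (double_difference s0) => b' a' bs' as2.
  by rewrite addrAC; split; [apply: dw|apply: dwv]; exact: mem_par.
have [_ [/= B1 _]] := dP _ (near_par a b as' bs).
have [_ [/= _ B2]] := dP _ (near_par a' b' as2 bs').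
move: E2; rewrite [x + s *: w + _]addrAC [x + b' *: w + _]addrAC.
by move=> E2; exact: (mixed_quotients_close s0 E1 E2 B1 B2).
Qed.

(** If the second derivative were negative, the first one, which vanishes at
    x, would be negative just after x, and f would decrease from its minimum. *)
Lemma second_derivative_at_min f (U : set V) x v : nbhs x U ->
  (forall y, U y -> derivable f y v) -> derivable ('D_v f) x v ->
  (forall y, U y -> f x <= f y) ->
  'D_v f x = 0 /\ 0 <= 'D_v ('D_v f) x.
Proof.
move=> Ux df ddf fmin.
have [d /= d0 dP] := nbhs_line v Ux.
have inU (s : R) : s \in `](- d), d[%R -> U (x + s *: v).
  rewrite in_itv /= -ltr_norml => sd; apply: dP.
  by rewrite /ball_/= sub0r normrN.
pose g (s : R) := f (x + s *: v).
have dg (s : R) : s \in `](- d), d[%R ->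
    is_derive s (1:R) g ('D_v f (x + s *: v)).
  by move=> /inU /df; exact: is_derive_line.
have g0 : x + (0:R) *: v = x by rewrite scale0r addr0.
have o0 : 0 \in `](- d), d[%R by rewrite in_itv /=; lra.
have D0 : 'D_v f x = 0.
  have Ng : - d <= d by lra.
  have [_] : is_derive (0:R) (1:R) g 0.
    apply: (derive1_at_min Ng _ o0) => [t /dg[]//|t /inU].
    by rewrite /g g0; exact: fmin.
  by have [_ ->] := dg _ o0; rewrite g0.
split=> //; rewrite leNgt; apply/negP => D2.
have : is_derive (0:R) (1:R) (fun s : R => 'D_v f (x + s *: v))
   ('D_v ('D_v f) (x + 0 *: v)) by apply: is_derive_line; rewrite g0.
rewrite g0 => d2.
have E0 : 'D_v f (x + (0 : R) *: v) = 0 by rewrite g0.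
have [e /= e0 eP] := near_quotient_lt0 d2 E0 D2.
pose s := Num.min d e / 2.
have [s0 sd se] : [/\ 0 < s, s < d & s < e].
  have m0 : 0 < Num.min d e by rewrite lt_min d0 e0.
  have s2 : s < Num.min d e by rewrite /s; lra.
  by split; [rewrite /s; lra|rewrite (lt_le_trans s2)// ge_min lexx
    |rewrite (lt_le_trans s2)// ge_min lexx orbT].
have dg0 (y : R) : y \in `]0, s[%R ->
    is_derive y (1:R) g ('D_v f (x + y *: v)).
  rewrite in_itv /= => /andP[y0 ys]; apply: dg.
  by rewrite in_itv /=; lra.
have gc : {within `[0, s], continuous g}.
  apply: derivable_within_continuous => y; rewrite in_itv /= => /andP[y0 ys].
  by have [|] := dg y; rewrite // in_itv /=; lra.
have [c cs0 E] := MVT s0 dg0 gc; move: cs0 E.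
rewrite in_itv /= subr0 => /andP[c0 cs] E.
have := eP c; rewrite /ball_ /= sub0r normrN gtr0_norm// => /(_ _ _).
move=> /(_ (lt_trans cs se)); rewrite gt_eqF// => /(_ isT).
rewrite pmulr_rlt0 ?invr_gt0// => neg.
have : g s - g 0 < 0 by rewrite E pmulr_llt0.
rewrite subr_lt0 ltNge => /negP; apply.
by rewrite /g g0; apply/fmin/inU; rewrite in_itv /=; lra.
Qed.

End Lines.

(** * Functions of class C^2 and the minorizing linear operator *)

Lemma eq_open_continuous (T : topologicalType) (R : realType) (U : set T)
    (f g : T -> R) : open U -> (forall y, U y -> f y = g y) ->
  {in U, continuous f} -> {in U, continuous g}.
Proof.
move=> oU fg cf x Ux; have := cf x Ux; move: Ux; rewrite inE => Ux.
rewrite /continuous_at -(fg x Ux); apply: cvg_trans.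
by apply: near_eq_cvg; apply: filterS (open_nbhs_nbhs (conj oU Ux)) => y /fg.
Qed.

Lemma symbolD (R : comPzRingType) (l c A A' B B' F F' : R) :
  l * (A + A') + (B + B') + c * (F + F') =
  l * A + B + c * F + (l * A' + B' + c * F').
Proof. ring. Qed.

Lemma symbolZ (R : comPzRingType) (l c a A B F : R) :
  l * (a * A) + a * B + c * (a * F) = a * (l * A + B + c * F).
Proof. ring. Qed.

Section C2Functions.
Context {R : realType} {n : nat}.
Local Notation V := 'rV[R]_n.+1.
Implicit Types (U : set V) (f g : V -> R).

Lemma C2_onW U W f : W `<=` U -> C2_on U f -> C2_on W f.
Proof.
move=> WU; have inWU y : y \in W -> y \in U by rewrite !inE; exact: WU.
move=> [cf f1 f2]; split=> [x /inWU/cf//|i|i j].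
  by have [d1 c1] := f1 i; split=> x /inWU; [exact: d1|exact: c1].
by have [d1 c1] := f2 i j; split=> x /inWU; [exact: d1|exact: c1].
Qed.

Lemma partialD i f g x : derivable f x (delta_mx 0 i) ->
  derivable g x (delta_mx 0 i) ->
  partial i (fun y => f y + g y) x = partial i f x + partial i g x.
Proof. by move=> df dg; rewrite /partial -deriveD. Qed.

Lemma partialZ i (a : R) f x : derivable f x (delta_mx 0 i) ->
  partial i (fun y => a * f y) x = a * partial i f x.
Proof. by move=> df; rewrite /partial -[RHS]deriveZ. Qed.

Lemma eq_open_partial U f g i : open U -> (forall y, U y -> f y = g y) ->
  forall y, U y -> partial i f y = partial i g y.
Proof.
move=> oU fg y Uy; apply: near_eq_derive.
by apply: filterS (open_nbhs_nbhs (conj oU Uy)) => z /fg.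
Qed.

Lemma eq_open_derivable U f g i : open U -> (forall y, U y -> f y = g y) ->
  forall y, U y -> derivable f y (delta_mx 0 i) ->
    derivable g y (delta_mx 0 i).
Proof.
move=> oU fg y Uy; apply: near_eq_derivable.
by apply: filterS (open_nbhs_nbhs (conj oU Uy)) => z /fg.
Qed.

Lemma C2_on_add U f g : open U -> C2_on U f -> C2_on U g ->
  C2_on U (fun y => f y + g y) /\
  forall i y, U y ->
    partial i (fun y => f y + g y) y = partial i f y + partial i g y /\
    partial i (partial i (fun y => f y + g y)) y =
      partial i (partial i f) y + partial i (partial i g) y.
Proof.
move=> oU [cf f1 f2] [cg g1 g2].
have inU y : U y -> y \in U by rewrite inE.
have p1 i y : U y ->
    partial i f y + partial i g y = partial i (fun y => f y + g y) y.
  by move=> /inU Uy; rewrite partialD//; [exact: (f1 i).1|exact: (g1 i).1].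
have p2 i j y : U y -> partial j (partial i f) y + partial j (partial i g) y =
    partial j (partial i (fun y => f y + g y)) y.
  move=> Uy; rewrite -(eq_open_partial j oU (@p1 i) Uy) partialD//.
    exact: (f2 i j).1 _ (inU _ Uy).
  exact: (g2 i j).1 _ (inU _ Uy).
split; last by move=> i y Uy; rewrite p1// p2.
split=> [x Ux|i|i j].
- exact: continuousD (cf x Ux) (cg x Ux).
- split=> [x Ux|].
    exact: derivableD ((f1 i).1 x Ux) ((g1 i).1 x Ux).
  apply: (eq_open_continuous oU (@p1 i)) => x Ux.
  exact: continuousD ((f1 i).2 x Ux) ((g1 i).2 x Ux).
- split=> [x Ux|].
    apply: (eq_open_derivable oU (@p1 i)); first by rewrite inE in Ux.
    exact: derivableD ((f2 i j).1 x Ux) ((g2 i j).1 x Ux).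
  apply: (eq_open_continuous oU (@p2 i j)) => x Ux.
  exact: continuousD ((f2 i j).2 x Ux) ((g2 i j).2 x Ux).
Qed.

Lemma C2_on_scale U f (a : R) : open U -> C2_on U f ->
  C2_on U (fun y => a * f y) /\
  forall i y, U y ->
    partial i (fun y => a * f y) y = a * partial i f y /\
    partial i (partial i (fun y => a * f y)) y = a * partial i (partial i f) y.
Proof.
move=> oU [cf f1 f2].
have inU y : U y -> y \in U by rewrite inE.
have p1 i y : U y -> a * partial i f y = partial i (fun y => a * f y) y.
  by move=> /inU Uy; rewrite partialZ//; exact: (f1 i).1.
have p2 i j y : U y -> a * partial j (partial i f) y =
    partial j (partial i (fun y => a * f y)) y.
  move=> Uy; rewrite -(eq_open_partial j oU (@p1 i) Uy) partialZ//.
  exact: (f2 i j).1 _ (inU _ Uy).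
split; last by move=> i y Uy; rewrite p1// p2.
split=> [x Ux|i|i j].
- exact: continuousM (cvg_cst _) (cf x Ux).
- split=> [x Ux|].
    exact: derivableZ ((f1 i).1 x Ux).
  apply: (eq_open_continuous oU (@p1 i)) => x Ux.
  exact: continuousM (cvg_cst _) ((f1 i).2 x Ux).
- split=> [x Ux|].
    apply: (eq_open_derivable oU (@p1 i)); first by rewrite inE in Ux.
    exact: derivableZ ((f2 i j).1 x Ux).
  apply: (eq_open_continuous oU (@p2 i j)) => x Ux.
  exact: continuousM (cvg_cst _) ((f2 i j).2 x Ux).
Qed.

(** The linear operator that minorizes [elliptic_op]; b and c are the values of
    its coefficients at the point x. *)
Definition laplace_op (lam : R) (b : V) (c : R) f (x : V) : R :=
  lam * (\sum_i partial i (partial i f) x) + \sum_i b 0 i * partial i f x +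
  c * f x.

Lemma laplace_opD lam b c U f g x : open U -> U x -> C2_on U f -> C2_on U g ->
  laplace_op lam b c (fun y => f y + g y) x =
  laplace_op lam b c f x + laplace_op lam b c g x.
Proof.
move=> oU Ux Cf Cg; have [_ E] := C2_on_add oU Cf Cg.
have S2 : \sum_i partial i (partial i (fun y => f y + g y)) x =
    \sum_i partial i (partial i f) x + \sum_i partial i (partial i g) x.
  by rewrite -big_split; apply: eq_bigr => i _; exact: (E i x Ux).2.
have S1 : \sum_i b 0 i * partial i (fun y => f y + g y) x =
    \sum_i b 0 i * partial i f x + \sum_i b 0 i * partial i g x.
  rewrite -big_split; apply: eq_bigr => i _ /=.
  by rewrite -mulrDr; congr (_ * _); exact: (E i x Ux).1.
exact: etrans (congr2 (fun A B => lam * A + B + c * (f x + g x)) S2 S1)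
  (symbolD _ _ _ _ _ _ _ _).
Qed.

Lemma laplace_opZ lam b c U f a x : open U -> U x -> C2_on U f ->
  laplace_op lam b c (fun y => a * f y) x = a * laplace_op lam b c f x.
Proof.
move=> oU Ux Cf; have [_ E] := C2_on_scale a oU Cf.
have S2 : \sum_i partial i (partial i (fun y => a * f y)) x =
    a * \sum_i partial i (partial i f) x.
  by rewrite mulr_sumr; apply: eq_bigr => i _; exact: (E i x Ux).2.
have S1 : \sum_i b 0 i * partial i (fun y => a * f y) x =
    a * \sum_i b 0 i * partial i f x.
  rewrite mulr_sumr; apply: eq_bigr => i _.
  by rewrite mulrCA; congr (_ * _); exact: (E i x Ux).1.
exact: etrans (congr2 (fun A B => lam * A + B + c * (a * f x)) S2 S1)
  (symbolZ _ _ _ _ _ _).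
Qed.

Lemma laplace_op_sum lam b c U x (m : nat) (w : nat -> R) (F : nat -> V -> R) :
  open U -> U x -> (forall k, (k < m)%N -> C2_on U (F k)) ->
  C2_on U (fun y => \sum_(k < m) w k * F k y) /\
  laplace_op lam b c (fun y => \sum_(k < m) w k * F k y) x =
    \sum_(k < m) w k * laplace_op lam b c (F k) x.
Proof.
move=> oU Ux; elim: m => [|m IH] CF.
  have C0 : C2_on U (fun _ => 0).
    have p0 i : partial i (fun _ : V => 0 : R) = (fun _ => 0).
      by apply/funext => y; exact: derive_cst.
    split=> [y _|i|i j]; first exact: cst_continuous.
      by rewrite p0; split=> y _;
        [exact: derivable_cst|exact: cst_continuous].
    by rewrite !p0; split=> y _;
      [exact: derivable_cst|exact: cst_continuous].
  have -> : (fun y => \sum_(k < 0) w k * F k y) = (fun _ => 0).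
    by apply/funext => y; rewrite big_ord0.
  split=> //; rewrite big_ord0.
  have E0 : (fun _ : V => 0 * (0 : R)) = (fun _ => 0).
    by apply/funext => y; rewrite mul0r.
  by have := laplace_opZ lam b c 0 oU Ux C0; rewrite E0 mul0r.
have [|C1 E1] := IH; first by move=> k km; apply: CF; rewrite ltnW.
have -> : (fun y => \sum_(k < m.+1) w k * F k y) =
    (fun y => (\sum_(k < m) w k * F k y) + w m * F m y).
  by apply/funext => y; rewrite big_ord_recr.
have Cm := CF m (ltnSn m).
have Cwm := (C2_on_scale (w m) oU Cm).1.
split; first exact: (C2_on_add oU C1 Cwm).1.
by rewrite (laplace_opD lam b c oU Ux C1 Cwm) E1 big_ord_recr/=
  (laplace_opZ _ _ _ _ oU Ux Cm).
Qed.

Lemma hessian_symmetric U f x : open U -> U x -> C2_on U f ->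
  (hessian f x)^T = hessian f x.
Proof.
move=> oU Ux [cf f1 f2]; apply/matrixP => i j; rewrite !mxE.
have nU : nbhs x U by exact: open_nbhs_nbhs.
have inU y : U y -> y \in U by rewrite inE.
apply: (derive_swap nU).
- by move=> y /inU; exact: (f1 j).1.
- by move=> y /inU; exact: (f1 i).1.
- by move=> y /inU; exact: (f2 j i).1.
- by move=> y /inU; exact: (f2 i j).1.
- exact: (f2 j i).2 x (inU x Ux).
- exact: (f2 i j).2 x (inU x Ux).
Qed.

Lemma laplace_le_elliptic lam Lam b c t U f x : lam <= Lam ->
  open U -> U x -> C2_on U f ->
  laplace_op lam (b x t) (c x t) f x <= elliptic_op lam Lam b c t f x.
Proof.
move=> lL oU Ux Cf; rewrite /laplace_op /elliptic_op !lerD2r.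
have := pucci_ge_trace lL (hessian_symmetric oU Ux Cf).
by rewrite /mxtrace; under eq_bigr do rewrite mxE.
Qed.

Lemma laplace_op_min lam b c U f x : 0 <= lam -> c <= 0 ->
  open U -> U x -> C2_on U f -> (forall y, U y -> f x <= f y) -> f x <= 0 ->
  0 <= laplace_op lam b c f x.
Proof.
move=> l0 c0 oU Ux [cf f1 f2] fmin fx.
have inU y : U y -> y \in U by rewrite inE.
have M i : partial i f x = 0 /\ 0 <= partial i (partial i f) x.
  apply: (second_derivative_at_min (open_nbhs_nbhs (conj oU Ux))) => //.
    by move=> y /inU; exact: (f1 i).1.
  exact: (f2 i i).1 x (inU x Ux).
rewrite /laplace_op [X in _ + X + _]big1 => [|i _]; last first.
  by rewrite (M i).1 mulr0.
rewrite addr0; apply: addr_ge0; last exact: mulr_le0.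
by apply: mulr_ge0 => //; apply: sumr_ge0 => i _; exact: (M i).2.
Qed.

End C2Functions.

(** * Euclidean norm, and covers from a small Hausdorff dimension *)

Section EuclideanNorm.
Context {R : realType} {n : nat}.
Implicit Types v : 'rV[R]_n.+1.

Lemma enorm_ge0 v : 0 <= enorm v.
Proof. exact: sqrtr_ge0. Qed.

Lemma coord_le_norm v i : `|v 0 i| <= `|v|.
Proof.
rewrite [leRHS]/Num.Def.normr /= mx_normrE; apply/bigmax_geP; right.
by exists (0, i) => //=.
Qed.

Lemma norm_le_enorm v : `|v| <= enorm v.
Proof.
rewrite [leLHS]/Num.Def.normr /= mx_normrE; apply/bigmax_leP; split.
  exact: enorm_ge0.
move=> [i j] _ /=; rewrite ord1 -sqrtr_sqr ler_sqrt ?sumr_ge0// => [|k _].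
  by rewrite (bigD1 j)//= lerDl sumr_ge0// => k _; exact: sqr_ge0.
exact: sqr_ge0.
Qed.

Lemma enorm_le_norm v : enorm v <= Num.sqrt n.+1%:R * `|v|.
Proof.
rewrite -[X in _ * X]ger0_norm// -[X in _ * X]sqrtr_sqr -sqrtrM//.
rewrite ler_sqrt ?mulr_ge0 ?sqr_ge0//.
have -> : n.+1%:R * `|v| ^+ 2 = \sum_(i < n.+1) `|v| ^+ 2.
  by rewrite sumr_const card_ord mulr_natl.
apply: ler_sum => i _; rewrite -real_normK ?num_real//.
by rewrite lerXn2r ?nnegrE// coord_le_norm.
Qed.

Lemma enorm_gt0 v : v != 0 -> 0 < enorm v.
Proof. by rewrite -normr_gt0 => /lt_le_trans; apply; exact: norm_le_enorm. Qed.

Lemma enorm0 : enorm (0 : 'rV[R]_n.+1) = 0.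
Proof.
apply/eqP; rewrite eq_le enorm_ge0 andbT (le_trans (enorm_le_norm _))//.
by rewrite normr0 mulr0.
Qed.

End EuclideanNorm.

Section HausdorffCover.
Context {R : realType} {n : nat}.
Local Notation V := 'rV[R]_n.+1.

Lemma sum_half_le1 (m : nat) : \sum_(k < m) (2^-1 : R) ^+ k.+1 <= 1.
Proof.
have -> : \sum_(k < m) (2^-1 : R) ^+ k.+1 = 1 - 2^-1 ^+ m.
  elim: m => [|m IH]; first by rewrite big_ord0 expr0 subrr.
  by rewrite big_ord_recr/= IH exprS; field.
by rewrite gerBl exprn_ge0.
Qed.

Lemma powR_max_le (a e mu : R) : 0 <= a -> 0 <= e ->
  Num.max a e `^ mu <= a `^ mu + e `^ mu.
Proof.
by move=> a0 e0; case: (leP a e) => _; rewrite ?lerDl ?lerDr powR_ge0.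
Qed.

(** At d = 0 the convention 0 `^ 0 = 1 makes the case s = 0 harmless, and
    0 `^ mu = 0 since mu > 0. *)
Lemma powR_le_exponent (d s mu : R) : 0 <= d -> d <= 1 -> s <= mu -> 0 < mu ->
  d `^ mu <= d `^ s.
Proof.
rewrite le_eqVlt => /predU1P[<- _ _ mu0|d0 d1 smu mu0].
  by rewrite powR0 ?gt_eqF ?powR_ge0.
by apply: ger_powR => //; rewrite d0.
Qed.

Lemma enorm_le_diam (U : set V) (x y : V) : U x -> U y ->
  ((enorm (x - y))%:E <= diam U)%E.
Proof. by move=> Ux Uy; apply: ereal_sup_ubound; exists (x, y). Qed.

Lemma diam_pow_ge0 (s : R) (U : set V) : (0 <= diam_pow s U)%E.
Proof. by rewrite /diam_pow; case: ifP => // _; exact: poweR_ge0. Qed.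

Lemma hausdorff_dim_cover (E : set V) (s delta eps : R) :
  hausdorff_measure s E = 0%E -> 0 < delta -> 0 < eps ->
  exists U : nat -> set V, [/\ E `<=` \bigcup_k U k,
    forall k, (diam (U k) <= delta%:E)%E &
    (\sum_(0 <= k <oo) diam_pow s (U k) < eps%:E)%E].
Proof.
move=> HE d0 e0.
have : (hausdorff_premeasure s delta E < eps%:E)%E.
  apply: (@le_lt_trans _ _ (hausdorff_measure s E)); last first.
    by rewrite HE lte_fin.
  by apply: ereal_sup_ubound; exists delta.
by move=> /ereal_inf_lt[_ [U [EU dU] <-] ltU]; exists U.
Qed.

(** Each set of an efficient cover that meets A is contained in a ball about one
    of its points of A.  A set of diameter 0 still needs a positive
    radius: the radius is the maximum of twice the diameter and of a number f k
    whose mu-th powers have a small geometric sum. *)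
Lemma ball_cover (E A : set V) (a0 : V) (mu eps : R) : 0 < mu ->
  (hausdorff_dim E < mu%:E)%E -> A `<=` E -> A a0 -> 0 < eps ->
  exists (z : nat -> V) (r : nat -> R),
    [/\ forall k, A (z k) /\ 0 < r k,
        forall x, A x -> exists k, `|x - z k| < r k &
        forall m, \sum_(k < m) r k `^ mu <= eps].
Proof.
move=> mu0 dimE AE Aa0 eps0.
have [_ [s [s0 HE] <-] smu] := ereal_inf_lt dimE; rewrite lte_fin in smu.
pose C := 2 `^ mu + 1.
have C0 : 0 < C by rewrite /C ltr_wpDl// powR_ge0.
pose e := eps / C.
have e0 : 0 < e by rewrite divr_gt0.
have [U [EU dU ltU]] := hausdorff_dim_cover HE ltr01 e0.
have point k : exists a, A a /\ ((U k `&` A !=set0) -> U k a).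
  have [[a [Ua Aa]]|none] := pselect (U k `&` A !=set0); first by exists a.
  by exists a0; split => // /none.
pose z k := projT1 (cid (point k)).
have Az k : A (z k) by rewrite /z; case: cid => a [].
have Uz k : U k `&` A !=set0 -> U k (z k) by rewrite /z; case: cid => a [].
pose d k := if `[< U k (z k) >] then fine (diam (U k)) else 0.
have dP k : 0 <= d k <= 1 /\ (((d k `^ s)%:E <= diam_pow s (U k))%E \/ d k = 0).
  rewrite /d; case: asboolP => [Uk|_]; last first.
    by rewrite lexx ler01; split=> //; right.
  have diam0 : (0%:E <= diam (U k))%E.
    by have := enorm_le_diam Uk Uk; rewrite subrr enorm0.
  have [r diamE] : exists r, diam (U k) = r%:E.
    have := dU k; move: diam0; case: (diam (U k)) => // r _ _.
    by exists r.
  move: diam0 (dU k); rewrite /diam_pow diamE /= !lee_fin => r0 r1.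
  rewrite r0 r1; split=> //; left; case: ifPn => [/eqP U0|_].
    by move: Uk; rewrite U0.
  exact: lexx.
have d_pow k : (((d k) `^ mu)%:E <= diam_pow s (U k))%E.
  have [/andP[d0 d1] [dk|->]] := dP k; last first.
    by rewrite powR0 ?gt_eqF// diam_pow_ge0.
  apply: le_trans dk; rewrite lee_fin powR_le_exponent//.
  exact: ltW.
pose f k : R := (e * 2^-1 ^+ k.+1) `^ mu^-1.
have f0 k : 0 < f k by rewrite powR_gt0// mulr_gt0// exprn_gt0// invr_gt0.
have fE k : f k `^ mu = e * 2^-1 ^+ k.+1.
  by rewrite /f -powRrM mulVf ?gt_eqF// powRr1// mulr_ge0 ?exprn_ge0// ltW.
exists z, (fun k => Num.max (2 * d k) (f k)); split=> [k|x Ax|m].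
- by split=> //; rewrite lt_max f0 orbT.
- have [k _ Ukx] := EU x (AE x Ax); exists k.
  have Ukz : U k (z k) by apply: Uz; exists x.
  rewrite lt_max; have [/andP[dk0 _] _] := dP k.
  have xz : `|x - z k| <= d k.
    rewrite /d asboolT// (le_trans (norm_le_enorm _))//.
    have := enorm_le_diam Ukx Ukz; have := dU k.
    case: (diam (U k)) => //=.
  move: dk0; rewrite le_eqVlt => /predU1P[dk0|dk0].
    by apply/orP; right; rewrite (le_lt_trans xz)// -dk0.
  by apply/orP; left; rewrite (le_lt_trans xz)//; lra.
have sum_d : \sum_(k < m) d k `^ mu <= e.
  rewrite -lee_fin; apply: le_trans (ltW ltU).
  apply: le_trans (nneseries_lim_ge m _); last by move=> *; exact: diam_pow_ge0.
  by rewrite big_mkord -sumEFin; apply: lee_sum => k _; exact: d_pow.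
apply: (@le_trans _ _ (\sum_(k < m) (2 `^ mu * d k `^ mu + e * 2^-1 ^+ k.+1))).
  apply: ler_sum => k _; have [/andP[dk0 _] _] := dP k.
  rewrite -fE -powRM//.
  by apply: powR_max_le; [exact: mulr_ge0|exact/ltW].
rewrite big_split/= -!mulr_sumr.
apply: (@le_trans _ _ (2 `^ mu * e + e * 1)).
  rewrite lerD// ler_wpM2l ?powR_ge0 ?(ltW e0)//.
  exact: sum_half_le1.
by rewrite mulr1 -{2}[e]mul1r -mulrDl -/C /e mulrC divfK ?gt_eqF.
Qed.

End HausdorffCover.

(** * Comparison at an interior minimum *)

(** The sublevel set {v <= v p1} of G stays away from the points of K outside G,
    so it equals the intersection of the compact set K with its own closure. *)
Lemma exists_interior_min (R : realType) (X : topologicalType) (K G : set X)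
    (v : X -> R) (p1 : X) :
  compact K -> G `<=` K -> {in G, continuous v} -> G p1 ->
  (forall p, K p -> ~ G p -> \forall q \near p, G q -> v p1 < v q) ->
  exists2 p, G p & v p <= v p1 /\ forall q, G q -> v p <= v q.
Proof.
move=> cK GK cv Gp1 bd.
pose S := [set p | G p /\ v p <= v p1].
have Sp1 : S p1 by split.
have SE : S = K `&` closure S.
  apply/seteqP; split=> [p Sp|p [Kp clp]].
    by split; [exact/GK/Sp.1|exact: subset_closure].
  have Gp : G p.
    apply: contrapT => nG; have [q [[Gq vq] lt]] := clp _ (bd p Kp nG).
    by have := lt Gq; rewrite ltNge vq.
  split=> //; rewrite leNgt; apply/negP => lt.
  have Gp' : p \in G by rewrite inE.
  have nlt : \forall q \near p, v p1 < v q by exact: cvgr_gt (cv p Gp') _ lt.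
  by have [q [[_ vq] ltq]] := clp _ nlt; move: vq; rewrite leNgt ltq.
have cS : compact S.
  by rewrite SE; apply: compact_closedI => //; exact: closed_closure.
have [|||p pS pmin] := @compact_EVT_min X R v S; first by exists p1.
- exact: cS.
- by apply: continuous_in_subspaceT => p; rewrite inE => -[Gp _];
    apply: cv; rewrite inE.
move: pS; rewrite inE => -[Gp vp]; exists p => //; split=> // q Gq.
have [vq|vq] := leP (v q) (v p1); last exact: le_trans vp (ltW vq).
by apply: pmin; rewrite inE.
Qed.

(** One-sided, because the minimum of the comparison argument may lie on the
    final time of the cylinder. *)
Lemma left_min_derive_le0 (R : realType) (w : R -> R) (a s l : R) : a < s ->
  is_derive s (1 : R) w l -> (forall y, a < y <= s -> w s <= w y) -> l <= 0.
Proof.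
move=> as' dw wmin; rewrite leNgt; apply/negP => l0.
have dg : is_derive (0 : R) (1 : R) (fun h => w s - w (s + h *: (1 : R))) (- l).
  have s0 : s + (0 : R) *: (1 : R) = s by rewrite scale0r addr0.
  have dl : is_derive (0 : R) (1 : R) (fun h => w (s + h *: (1 : R))) l.
    have [dw1 <-] := dw; rewrite -{2}s0; apply: is_derive_line.
    by rewrite s0.
  rewrite -[X in is_derive _ _ _ X]add0r.
  exact: (is_deriveB (f := cst (w s))).
have g0 : w s - w (s + (0 : R) *: (1 : R)) = 0 by rewrite scale0r addr0 subrr.
have [|e /= e0 eP] := near_quotient_lt0 dg g0; first by rewrite oppr_lt0.
pose h := Num.min e (s - a) / 2.
have m0 : 0 < Num.min e (s - a) by rewrite lt_min e0 subr_gt0.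
have h0 : 0 < h by rewrite /h; lra.
have hm : h < Num.min e (s - a) by rewrite /h; lra.
have [he ha] : h < e /\ h < s - a by move: hm; rewrite lt_min => /andP.
have := eP (- h); rewrite /ball_ /= sub0r normrN normrN gtr0_norm//.
move=> /(_ he); rewrite oppr_eq0 gt_eqF// => /(_ isT).
rewrite nmulr_rlt0 ?invr_lt0 ?oppr_lt0// subr_gt0 ltNge => /negP; apply.
apply: wmin; rewrite [_ *: _]mulr1; lra.
Qed.

Section Comparison.
Context {R : realType} {n : nat}.
Local Notation V := 'rV[R]_n.+1.
Variables (lam Lam T : R) (Omega : set V).
Variables (b : V -> R -> V) (c : V -> R -> R) (u : V -> R -> R) (L : R).
Hypothesis lam0 : 0 < lam.
Hypothesis lamLam : lam < Lam.
Hypothesis oOmega : open Omega.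
Hypothesis c_le0 : forall x t, cylinder Omega T (x, t) -> c x t <= 0.
Hypothesis Cu : C21_on (cylinder Omega T) u.
Hypothesis Lu : forall x t, cylinder Omega T (x, t) ->
  parabolic_op lam Lam b c u x t <= L.

Lemma C21_slice t : 0 < t < T -> C2_on Omega (u^~ t).
Proof.
move=> tT.
have inQ x : x \in Omega -> (x, t) \in cylinder Omega T by rewrite !inE.
have pairC (h : V * R -> R) x : {for (x, t), continuous h} ->
    {for x, continuous (fun y => h (y, t))}.
  move=> ch; apply: (@continuous_comp _ _ _ (fun y => (y, t)) h);
    last exact: ch.
  have : (y, t) @[y --> x] --> (x, t).
    apply: (@cvg_pair _ _ _ (nbhs x) (nbhs x) (nbhs t)); first exact: cvg_id.
    exact: cvg_cst.
  exact.
have [c0 c1 c2 _] := Cu; split=> [x /inQ xQ|i|i j].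
- exact: pairC (c0 _ xQ).
- split=> x /inQ xQ; first exact: (c1 i).1 _ xQ.
  exact: pairC ((c1 i).2 _ xQ).
- split=> x /inQ xQ; first exact: (c2 i j).1 _ xQ.
  exact: pairC ((c2 i j).2 _ xQ).
Qed.

(** A strict supersolution in the sense of test functions: at each point W is
    touched from above by a translate of a C^2 function g with P_t g <= -M
    there.  The inequality g x <= W x makes g inherit the sign that c <= 0
    requires. *)
Definition touched_supersolution (D : set V) (W : V -> R) (M : R) :=
  forall x, D x -> exists g, [/\ C2_on D g, g x <= W x,
    forall y, D y -> W y <= W x + (g y - g x) &
    forall t, 0 < t < T -> laplace_op lam (b x t) (c x t) g x <= - M].

(** At a negative interior minimum (x, s) of v, replace W by its test function
    g at x.  Then u(., s) + g still has a minimum at x, with nonpositive value,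
    so P_s of it is nonnegative; but the equation for u, the sign of the time
    derivative at s and the strictness of g make it negative. *)
Lemma comparison (D : set V) (K : set (V * R)) (W : V -> R)
    (t0 ta tb beta tau eps M : R) :
  let v := fun p : V * R => u p.1 p.2 + W p.1 + beta * (p.2 - t0) ^+ 2 + eps in
  let G := D `*` [set t | ta < t <= tb] in
  open D -> D `<=` Omega -> {in D, continuous W} ->
  0 <= ta -> tb < T -> 0 <= beta -> 0 <= eps ->
  (forall t, ta < t <= tb -> `|t - t0| <= tau) ->
  L + 2 * beta * tau < M -> touched_supersolution D W M ->
  compact K -> G `<=` K ->
  (forall p, K p -> ~ G p -> \forall q \near p, G q -> 0 <= v q) ->
  forall p, G p -> 0 <= v p.
Proof.
move=> v G oD DO cW ta0 tbT beta0 eps0 tauP LM TW cK GK bd p1 Gp1.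
rewrite leNgt; apply/negP => vp1.
have GQ p : G p -> cylinder Omega T p.
  move=> [/DO Op /= /andP[ap pb]]; split=> //=.
  by rewrite (le_lt_trans ta0 ap) (le_lt_trans pb tbT).
have cv : {in G, continuous v}.
  move=> p; rewrite inE => Gp.
  have [Dp _] := Gp.
  have [cu _ _ _] := Cu.
  have ct : {for p, continuous (fun p : V * R => beta * (p.2 - t0) ^+ 2)}.
    have cs : {for p, continuous (fun p : V * R => p.2 - t0)}.
      by apply: continuousB; [exact: cvg_snd|exact: cvg_cst].
    apply: continuousM; first exact: cvg_cst.
    exact: (continuousM cs cs).
  have cWp : {for p, continuous (fun p : V * R => W p.1)}.
    apply: (@continuous_comp _ _ _ fst W); first exact: cvg_fst.
    by apply: cW; rewrite inE.
  have cup : {for p, continuous (fun p : V * R => u p.1 p.2)}.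
    by apply: cu; rewrite inE; exact: GQ.
  have ce : {for p, continuous (fun _ : V * R => eps)} by exact: cvg_cst.
  exact: (continuousD (continuousD (continuousD cup cWp) ct) ce).
have [|[x s] Gxs [vxs vmin]] := exists_interior_min cK GK cv Gp1.
  move=> p Kp nG; apply: filterS (bd p Kp nG) => q vq Gq.
  exact: lt_le_trans vp1 (vq Gq).
have [Dx /= /andP[as' sb]] := Gxs.
have sT : 0 < s < T by rewrite (le_lt_trans ta0 as') (le_lt_trans sb tbT).
have Qxs : cylinder Omega T (x, s) by exact: GQ.
have vneg : v (x, s) < 0 by exact: le_lt_trans vxs vp1.
have du : is_derive s (1 : R) (u x) (derive1 (u x) s).
  have [_ _ _ [dt _]] := Cu.
  have ds : derivable (u x) s 1 by apply: (dt (x, s)); rewrite inE.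
  by rewrite derive1E; exact: derivableP.
have time_cond : derive1 (u x) s + beta * (2 * (s - t0)) <= 0.
  apply: (left_min_derive_le0
    (w := fun y => u x y + beta * (y - t0) ^+ 2) as').
    apply: is_deriveD.
    apply: is_derive_eq.
    rewrite /GRing.scale/=; ring.
  move=> y /andP[ay ys].
  have := vmin (x, y); rewrite /v /= => -/(_ _) H.
  have {}H := H (conj Dx _).
  have := H; rewrite /= ay (le_trans ys sb) => /(_ isT); lra.
have [g [Cg gW gtouch gM]] := TW x Dx.
pose f y := u y s + g y.
have CuD : C2_on D (u^~ s) by exact: C2_onW DO (C21_slice sT).
have Cf : C2_on D f by exact: (C2_on_add oD CuD Cg).1.
have fmin y : D y -> f x <= f y.
  move=> Dy; have /(_ (conj Dy _)) := vmin (y, s).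
  rewrite /= as' sb => /(_ isT); rewrite /v /f /=.
  by have := gtouch y Dy; lra.
have fx : f x <= 0.
  move: vneg; rewrite /v /f /=; have := mulr_ge0 beta0 (sqr_ge0 (s - t0)).
  lra.
have := laplace_op_min (b x s) (ltW lam0) (c_le0 Qxs) oD Dx Cf fmin fx.
rewrite (laplace_opD _ _ _ oD Dx CuD Cg).
have := laplace_le_elliptic b c s (ltW lamLam) oD Dx CuD.
have := Lu Qxs; rewrite /parabolic_op.
have := gM s sT.
have [|tau1 tau2] := ler_normlP _ _ (tauP s _); first by rewrite as' sb.
have : beta * (s - t0) >= - (beta * tau).
  by rewrite -mulrN ler_wpM2l//; lra.
move: time_cond LM.
move: (derive1 _ _) (laplace_op _ _ _ _ _) (laplace_op _ _ _ _ _)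
  (elliptic_op _ _ _ _ _ _ _) => A1 A2 A3 A4.
lra.
Qed.

End Comparison.

(** * Lower limits at the boundary, and real powers *)

Lemma nonneg_atP (R : realType) (n : nat) (Q : set ('rV[R]_n.+1 * R))
    (u : 'rV[R]_n.+1 -> R -> R) (p : 'rV[R]_n.+1 * R) :
  nonneg_at Q u p <->
  forall eps, 0 < eps -> \forall q \near p, Q q -> - eps <= u q.1 q.2.
Proof.
rewrite /nonneg_at limf_einfE; split=> [u0 eps e0|H].
  have : ((- eps)%:E < ereal_sup [set ereal_inf
      [set (u q.1 q.2)%:E | q in V] | V in within Q (nbhs p)])%E.
    by apply: lt_le_trans u0; rewrite lte_fin oppr_lt0.
  move=> /ereal_sup_gt[_ [A QA <-] ltA].
  have {}QA : \forall q \near p, Q q -> A q by [].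
  apply: filterS QA => q /[apply] Aq; rewrite -lee_fin (le_trans (ltW ltA))//.
  by apply: ereal_inf_lbound; exists q => //; exact: Aq.
apply/lee_addgt0Pr => eps e0.
have -> : 0%E = ((- eps)%:E + eps%:E)%E by rewrite -EFinD addNr.
rewrite leeD2r//; apply: (@le_trans _ _ (ereal_inf
  [set (u q.1 q.2)%:E | q in [set q | Q q -> - eps <= u q.1 q.2] `&` Q])).
  by apply: le_ereal_inf_tmp => _ [q [/= + Qq] <-] => /(_ Qq); rewrite lee_fin.
apply: ereal_sup_ubound.
exists ([set q | Q q -> - eps <= u q.1 q.2] `&` Q) => //.
by apply: filterS (H eps e0) => q Hq Qq.
Qed.

Section Powers.
Context {R : realType}.

Lemma powR_continuous (T : topologicalType) (g : T -> R) (th : R) (x : T) :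
  {for x, continuous g} -> 0 < g x -> {for x, continuous (fun y => g y `^ th)}.
Proof.
move=> cg gx; apply: (@continuous_comp _ _ _ g (fun a => a `^ th)) => //.
apply: differentiable_continuous; apply/derivable1_diffP.
by apply: derivable_powR; rewrite in_itv/= gx.
Qed.

(** Young's inequality with exponents 1/th and 1/(1-th), applied to
    (Y/X)^th and 1, gives the concavity bound at X = 1; the general case
    follows by homogeneity. *)
Lemma powR_le_tangent (th X Y : R) : 0 < th -> th < 1 -> 0 < X -> 0 <= Y ->
  Y `^ th <= X `^ th + th * X `^ (th - 1) * (Y - X).
Proof.
move=> th0 th1 X0 Y0.
have := @conjugate_powR R ((Y / X) `^ th) 1 th^-1 (1 - th)^-1.
rewrite powR_ge0 ler01 !invr_gt0 th0 subr_gt0 th1 !invrK addrCA subrr addr0.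
move=> /(_ isT isT isT isT erefl).
rewrite mulr1 powR1 -powRrM mulfV ?gt_eqF// powRr1 ?divr_ge0 ?(ltW X0)//.
move=> H.
have -> : X `^ (th - 1) = X `^ th / X.
  by rewrite powRD ?powR_inv1 ?(ltW X0)// (gt_eqF X0) implybT.
have -> : Y `^ th = (Y / X) `^ th * X `^ th.
  by rewrite -powRM ?divr_ge0 ?(ltW X0)// divfK ?gt_eqF.
have := ler_wpM2r (powR_ge0 X th) H.
have -> : (Y / X * th + 1 * (1 - th)) * X `^ th =
   X `^ th + th * (X `^ th / X) * (Y - X).
  by field; rewrite gt_eqF.
by [].
Qed.

Lemma powR_antitone (p x y : R) : p <= 0 -> 0 < x -> x <= y -> y `^ p <= x `^ p.
Proof.
move=> p0 x0 xy; have y0 := lt_le_trans x0 xy.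
rewrite -[p]opprK [in leLHS]powRN [in leRHS]powRN.
rewrite lef_pV2 ?posrE ?powR_gt0// ge0_ler_powR ?oppr_ge0//;
 by rewrite nnegrE ltW.
Qed.

End Powers.

(** * Majorants built from the barriers *)

Section Barriers.
Context {R : realType} {n : nat}.
Local Notation V := 'rV[R]_n.+1.
Local Notation kappa := (Num.sqrt n.+1%:R : R).
Variables (lam Lam T : R) (Omega : set V).
Variables (b : V -> R -> V) (c : V -> R -> R).
Hypothesis lamLam : lam < Lam.
Hypothesis oOmega : open Omega.

Local Notation nearby z0 rho := (Omega `&` [set x | `|x - z0| < rho]).

Lemma kappa_gt0 : 0 < kappa.
Proof. by rewrite sqrtr_gt0 ltr0n. Qed.

Lemma open_ball_norm (z : V) (r : R) : open [set x : V | `|x - z| < r].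
Proof.
have -> : [set x : V | `|x - z| < r] = (fun x => `|x - z|) @^-1` [set s | s < r].
  by [].
apply: open_comp => [x _|]; last exact: open_lt.
exact: cvg_norm (cvgB cvg_id (cvg_cst z)).
Qed.

Lemma open_nearby (z0 : V) (rho : R) : open (nearby z0 rho).
Proof. by apply: openI => //; exact: open_ball_norm. Qed.

(** The constant A is the sum of A1, which makes P_t W <= -M, and A2, which
    makes W >= L away from z0.  The radius is so small that |x - z0| < 1,
    hence |x - z0|^p >= 1 for the negative exponents p that occur. *)
Lemma regular_majorant (z0 : V) (eta : R) (h : V -> V -> R) :
  ~ Omega z0 -> 0 < eta ->
  barrier_family (elliptic_op lam Lam b c) T Omega [set z0] eta h ->
  exists2 rho1 : R, 0 < rho1 & forall rho M L : R, 0 < rho -> rho <= rho1 ->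
  0 <= M -> 0 <= L -> exists W : V -> R,
  [/\ {in nearby z0 rho, continuous W},
      touched_supersolution lam T b c (nearby z0 rho) W M,
      forall x, nearby z0 rho x -> 0 <= W x,
      forall x, nearby z0 rho x -> rho / 2 < `|x - z0| -> L <= W x &
      forall eps : R, 0 < eps -> exists2 d : R, 0 < d &
        forall x, nearby z0 rho x -> `|x - z0| < d -> W x <= eps].
Proof.
move=> z0O eta0 [r0 [D1 [D2 [D3 [D4 [D5 [[r00 D10 D20 [_ _ D50]] Hb]]]]]]].
have [_ Ch hP] := Hb z0 erefl; move: Ch hP; set h0 := h z0 => Ch hP {Hb}.
have k0 := kappa_gt0.
exists (Num.min r0 1 / kappa); first by rewrite divr_gt0// lt_min r00 ltr01.
move=> rho M L rho0; rewrite ler_pdivlMr// le_min => /andP[rhor rho1] M0 L0.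
(* Any th with eta * th <= 2 and th < 1 would do; this one gives
   eta * th = 1 - th. *)
pose th := (1 + eta)^-1.
have th0 : 0 < th by rewrite invr_gt0; lra.
have th1 : th < 1 by rewrite invf_lt1; lra.
have etath : eta * th = 1 - th by rewrite /th; field; lra.
pose e x := enorm (x - z0).
have eP x : nearby z0 rho x ->
    [/\ 0 < e x, e x < 1, punctured_ball z0 r0 x & `|x - z0| <= e x].
  move=> [Ox xz]; have xz0 : x - z0 != 0.
    by rewrite subr_eq0; apply/eqP => xE; apply: z0O; rewrite -xE.
  have ex0 := enorm_gt0 xz0.
  have ex1 : e x < rho * kappa.
    apply: le_lt_trans (enorm_le_norm _) _.
    by rewrite mulrC ltr_pM2r.
  split=> //; first exact: lt_le_trans ex1 rho1.
    by rewrite /punctured_ball /= ex0 (lt_le_trans ex1 rhor).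
  exact: norm_le_enorm.
have hb x : nearby z0 rho x ->
    [/\ 0 < h0 x, D1 * e x `^ eta <= h0 x & h0 x <= D2 * e x `^ eta].
  move=> Dx; have [e0 e1 pb _] := eP x Dx.
  have [/andP[lo hi] _ _ _] := hP x Dx.1 pb.
  by split=> //; apply: lt_le_trans lo; rewrite mulr_gt0// powR_gt0.
pose A1 : R := M / (th * D2 `^ (th - 1) * D5).
pose A2 : R := L / (D1 `^ th * (rho / 2) `^ (eta * th)).
have q1 : 0 < th * D2 `^ (th - 1) * D5 by rewrite !mulr_gt0// powR_gt0.
have q2 : 0 < D1 `^ th * (rho / 2) `^ (eta * th).
  by rewrite mulr_gt0// powR_gt0// divr_gt0.
have A10 : 0 <= A1 by rewrite divr_ge0// ltW.
have A20 : 0 <= A2 by rewrite divr_ge0// ltW.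
pose A : R := A1 + A2.
have A0 : 0 <= A by rewrite addr_ge0.
have DU : nearby z0 rho `<=` Omega `&` punctured_ball z0 r0.
  by move=> x Dx; have [_ _ pb _] := eP x Dx; split=> //; exact: Dx.1.
have Ch' : C2_on (nearby z0 rho) h0 by exact: C2_onW DU Ch.
have oD : open (nearby z0 rho) by exact: open_nearby.
exists (fun x => A * h0 x `^ th); split.
- move=> x; rewrite inE => Dx; have [hx _ _] := hb x Dx.
  have ch : {for x, continuous h0}.
    by have [ch _ _] := Ch'; exact: (ch x (mem_set Dx)).
  have cA : {for x, continuous (fun _ : V => A)} by exact: cst_continuous.
  exact: (continuousM cA (powR_continuous ch hx)).
- move=> x Dx; have [hx lo hi] := hb x Dx; have [e0 e1 pb _] := eP x Dx.
  pose a : R := A * (th * h0 x `^ (th - 1)).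
  have a0 : 0 <= a by rewrite /a mulr_ge0// mulr_ge0 ?powR_ge0 ?(ltW th0).
  exists (fun y => a * h0 y); split.
  + exact: (C2_on_scale a oD Ch').1.
  + rewrite /a -!mulrA ler_wpM2l//.
    rewrite [h0 x `^ _ * _](_ : _ = h0 x `^ th).
      by rewrite ler_piMl ?powR_ge0// ltW.
    rewrite -[X in _ * X]powRr1 ?(ltW hx)// -powRD ?subrK//.
    by rewrite (gt_eqF hx) implybT.
  + move=> y Dy; have [hy _ _] := hb y Dy.
    rewrite -mulrBr /a -mulrA -mulrDr ler_wpM2l//.
    exact: powR_le_tangent (ltW hy).
  + move=> t tT; rewrite (laplace_opZ _ _ _ _ oD Dx Ch').
    have [_ _ _ hM] := hP x Dx.1 pb.
    apply: (@le_trans _ _ (a * (- D5 * e x `^ (eta - 2)))).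
      rewrite ler_wpM2l//; apply: le_trans (hM t tT).
      exact: laplace_le_elliptic (ltW lamLam) oD Dx Ch'.
    rewrite mulNr mulrN lerN2.
    have hp : (D2 * e x `^ eta) `^ (th - 1) <= h0 x `^ (th - 1).
      by apply: powR_antitone => //; lra.
    have ep : 1 <= e x `^ (eta * (th - 1)) * e x `^ (eta - 2).
      rewrite -powRD; last by rewrite (gt_eqF e0) implybT.
      have -> : eta * (th - 1) + (eta - 2) = - (1 + th).
        by rewrite mulrBr mulr1 etath; ring.
      have := @powR_antitone R (- (1 + th)) (e x) 1 _ e0 (ltW e1).
      by rewrite powR1; apply; lra.
    have hp2 : D2 `^ (th - 1) <= h0 x `^ (th - 1) * e x `^ (eta - 2).
      apply: (@le_trans _ _ ((D2 * e x `^ eta) `^ (th - 1) * e x `^ (eta - 2))).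
        rewrite powRM ?powR_ge0 ?(ltW D20)// -powRrM -mulrA.
        by rewrite ler_peMr// powR_ge0.
      by rewrite ler_wpM2r// powR_ge0.
    apply: (@le_trans _ _ (A1 * (th * D2 `^ (th - 1) * D5))).
      by rewrite /A1 divfK// gt_eqF.
    have -> : a * (D5 * e x `^ (eta - 2)) =
        A * (th * (h0 x `^ (th - 1) * e x `^ (eta - 2)) * D5).
      by rewrite /a; ring.
    apply: ler_pM => //; first exact: ltW.
      by rewrite lerDl.
    by rewrite ler_pM2r// ler_pM2l.
- by move=> x Dx; rewrite mulr_ge0// powR_ge0.
- move=> x Dx xz; have [hx lo hi] := hb x Dx; have [e0 e1 pb xe] := eP x Dx.
  apply: (@le_trans _ _ (A2 * (D1 `^ th * (rho / 2) `^ (eta * th)))).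
    by rewrite /A2 divfK// gt_eqF.
  apply: ler_pM => //; first exact: ltW.
    by rewrite lerDr.
  apply: (@le_trans _ _ ((D1 * e x `^ eta) `^ th)).
    rewrite [(D1 * _) `^ th]powRM ?powR_ge0 ?(ltW D10)// -powRrM.
    rewrite ler_wpM2l ?powR_ge0//.
    apply: ge0_ler_powR; rewrite ?nnegrE; [by rewrite mulr_ge0// ltW
      |by rewrite divr_ge0// ltW|exact: ltW|].
    exact: ltW (lt_le_trans xz xe).
  apply: ge0_ler_powR; rewrite ?nnegrE ?(ltW th0) ?(ltW hx)//.
  by rewrite mulr_ge0 ?powR_ge0// ltW.
- move=> eps eps0.
  pose C : R := A * D2 `^ th + 1.
  have C0 : 0 < C by rewrite ltr_wpDl// mulr_ge0// powR_ge0.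
  have et0 : 0 < eta * th by rewrite mulr_gt0.
  have [d d0 dE] : exists2 d : R, 0 < d & d `^ (eta * th) = eps / C.
    exists ((eps / C) `^ (eta * th)^-1); first by rewrite powR_gt0// divr_gt0.
    by rewrite -powRrM mulVf ?gt_eqF// powRr1// divr_ge0// ltW.
  exists (d / kappa); first by rewrite divr_gt0.
  move=> x Dx; rewrite ltr_pdivlMr// => xz.
  have [hx lo hi] := hb x Dx; have [e0 e1 pb xe] := eP x Dx.
  have ed : e x <= d.
    by rewrite (le_trans (enorm_le_norm _))// mulrC ltW.
  apply: (@le_trans _ _ (A * (D2 `^ th * d `^ (eta * th)))).
    rewrite ler_wpM2l//.
    apply: (@le_trans _ _ ((D2 * e x `^ eta) `^ th)).
      apply: ge0_ler_powR; rewrite ?nnegrE ?(ltW th0) ?(ltW hx)//.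
      by rewrite mulr_ge0 ?powR_ge0// ltW.
    rewrite [(D2 * _) `^ th]powRM ?powR_ge0 ?(ltW D20)// -[(e x `^ _) `^ _]powRrM.
    rewrite ler_wpM2l ?powR_ge0//.
    by apply: ge0_ler_powR; rewrite ?nnegrE ?(ltW et0) ?(ltW e0) ?(ltW d0).
  rewrite dE mulrA mulrCA ler_piMr ?(ltW eps0)// ler_pdivrMr// mul1r.
  by rewrite /C lerDl.
Qed.

(** On B(z_k, r_k) the k-th term is at least C1 (r_k / |x - z_k|)^mu; the balls
    are those of the sup norm, whence the power of [kappa] in [gam].  The
    radius rho1 ensures that the barrier at z_k is defined on the whole
    neighborhood of z0. *)
Lemma singular_majorant (E : set V) (z0 : V) (mu : R) (h : V -> V -> R) :
  E `<=` ~` Omega -> 0 < mu ->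
  barrier_family (elliptic_op lam Lam b c) T Omega E (- mu) h ->
  exists rho1 gam C : R, [/\ 0 < rho1, 0 < gam & 0 < C] /\
  forall (rho : R) (z : nat -> V) (r : nat -> R), rho <= rho1 ->
  (forall k, (E (z k) /\ `|z k - z0| < rho) /\ 0 < r k) -> forall m : nat,
  let S := fun x => \sum_(k < m) r k `^ mu * h (z k) x in
  [/\ C2_on (nearby z0 rho) S,
      forall x t, nearby z0 rho x -> 0 < t < T ->
        laplace_op lam (b x t) (c x t) S x <= 0,
      forall x, nearby z0 rho x -> 0 <= S x,
      forall x k, nearby z0 rho x -> (k < m)%N -> `|x - z k| < r k ->
        gam <= S x &
      forall x d, nearby z0 rho x -> 0 < d -> (forall k, d <= `|x - z k|) ->
        S x <= C * d `^ (- mu) * \sum_(k < m) r k `^ mu].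
Proof.
move=> EO mu0 [r0 [C1 [C2 [C3 [C4 [C5 [[r00 C10 C20 [_ _ C50]] Hb]]]]]]].
have k0 := kappa_gt0.
exists (r0 / kappa / 2), (C1 * kappa `^ (- mu)), C2; split.
  by split=> //; rewrite ?divr_gt0// mulr_gt0// powR_gt0.
move=> rho z r rho1 zP m S.
have oD : open (nearby z0 rho) by exact: open_nearby.
have pb x k : nearby z0 rho x -> punctured_ball (z k) r0 x.
  move=> [Ox xz]; have [[Ez zz] _] := zP k.
  have xzk : x - z k != 0.
    by rewrite subr_eq0; apply/eqP => xE; apply: (EO _ Ez); rewrite -xE.
  rewrite /punctured_ball /= enorm_gt0//=.
  apply: le_lt_trans (enorm_le_norm _) _.
  have H : `|x - z k| < 2 * rho.
    have -> : x - z k = (x - z0) - (z k - z0) by rewrite opprB addrA subrK.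
    by apply: le_lt_trans (ler_normB _ _) _; rewrite mulr2n mulrDl mul1r ltrD.
  have {}H : `|x - z k| < r0 / kappa by apply: lt_le_trans H _; lra.
  by move: H; rewrite ltr_pdivlMr// mulrC.
have hb x k : nearby z0 rho x ->
    C1 * enorm (x - z k) `^ (- mu) <= h (z k) x <=
    C2 * enorm (x - z k) `^ (- mu) /\ (forall t, 0 < t < T ->
      elliptic_op lam Lam b c t (h (z k)) x <= 0).
  move=> Dx; have [_ _ /(_ x Dx.1 (pb x k Dx))[lohi _ _ hM]] := Hb _ (zP k).1.1.
  split=> // t tT; apply: le_trans (hM t tT) _.
  by rewrite mulNr oppr_le0 mulr_ge0 ?powR_ge0// ltW.
have Ch k : C2_on (nearby z0 rho) (h (z k)).
  have [_ Ck _] := Hb _ (zP k).1.1; apply: C2_onW Ck => x Dx.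
  by split; [exact: Dx.1|exact: pb].
have h_ge0 x k : nearby z0 rho x -> 0 <= h (z k) x.
  move=> Dx; have [/andP[lo _] _] := hb x k Dx; apply: le_trans lo.
  by rewrite mulr_ge0 ?powR_ge0// ltW.
have term_ge0 x k : nearby z0 rho x -> 0 <= r k `^ mu * h (z k) x.
  by move=> Dx; rewrite mulr_ge0 ?powR_ge0// h_ge0.
have sumP x bb cc := fun Dx =>
  @laplace_op_sum R n lam bb cc (nearby z0 rho) x m (fun k => r k `^ mu)
    (fun k => h (z k)) oD Dx (fun k _ => Ch k).
split.
- have [D0|] := pselect (nearby z0 rho !=set0).
    by have [x Dx] := D0; have [] := sumP x 0 0 Dx.
  move=> nD; have nD' x : x \in nearby z0 rho -> False.
    by rewrite inE => Dx; apply: nD; exists x.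
  by split=> [x /nD'//|i|i j]; split=> x /nD'.
- move=> x t Dx tT; have [_ ->] := sumP x (b x t) (c x t) Dx.
  rewrite -oppr_ge0 -sumrN; apply: sumr_ge0 => k _.
  rewrite oppr_ge0 mulr_ge0_le0 ?powR_ge0//.
  apply: le_trans (laplace_le_elliptic b c t (ltW lamLam) oD Dx (Ch k)) _.
  by have [_] := hb x k Dx; apply.
- by move=> x Dx; apply: sumr_ge0 => k _; exact: term_ge0.
- move=> x k Dx km xr.
  rewrite /S (bigD1 (Ordinal km))//=; apply: ler_wpDr.
    by apply: sumr_ge0 => i _; exact: term_ge0.
  have [/andP[lo _] _] := hb x k Dx.
  have [_ rk0] := zP k.
  apply: (@le_trans _ _ (r k `^ mu * (C1 * enorm (x - z k) `^ (- mu)))); last first.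
    by rewrite ler_wpM2l ?powR_ge0.
  have /andP[e0 _] := pb x k Dx.
  have ek : enorm (x - z k) <= kappa * r k.
    by apply: le_trans (enorm_le_norm _) _; rewrite ler_wpM2l// ltW.
  apply: (@le_trans _ _ (r k `^ mu * (C1 * (kappa * r k) `^ (- mu)))); last first.
    rewrite ler_wpM2l ?powR_ge0// ler_wpM2l ?(ltW C10)//.
    by apply: powR_antitone => //; rewrite oppr_le0 ltW.
  rewrite powRM ?(ltW k0) ?(ltW rk0)// [r k `^ (- mu)]powRN.
  have rmu : r k `^ mu != 0 by rewrite gt_eqF// powR_gt0.
  by rewrite mulrCA [X in _ <= _ * X]mulrCA mulfV// mulr1.
- move=> x d Dx d0 dx; rewrite mulr_sumr; apply: ler_sum => k _.
  rewrite mulrC; apply: ler_wpM2r; first exact: powR_ge0.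
  have [/andP[_ hi] _] := hb x k Dx; apply: le_trans hi _.
  rewrite ler_wpM2l ?(ltW C20)//; apply: powR_antitone => //.
    by rewrite oppr_le0 ltW.
  exact: le_trans (dx k) (norm_le_enorm _).
Qed.

End Barriers.

(** * Compactness in space-time cylinders *)

Lemma touched_supersolution_add (R : realType) (n : nat) (lam T : R)
    (b : 'rV[R]_n.+1 -> R -> 'rV[R]_n.+1) (c : 'rV[R]_n.+1 -> R -> R)
    (D : set 'rV[R]_n.+1) (W S : 'rV[R]_n.+1 -> R) (M k : R) :
  open D -> 0 <= k -> touched_supersolution lam T b c D W M -> C2_on D S ->
  (forall x t, D x -> 0 < t < T -> laplace_op lam (b x t) (c x t) S x <= 0) ->
  touched_supersolution lam T b c D (fun x => W x + k * S x) M.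
Proof.
move=> oD k0 TW CS LS x Dx; have [g [Cg gW gt gM]] := TW x Dx.
have CkS := (C2_on_scale k oD CS).1.
exists (fun y => g y + k * S y); split.
- exact: (C2_on_add oD Cg CkS).1.
- by rewrite lerD2r.
- by move=> y Dy; have := gt y Dy; lra.
- move=> t tT; rewrite (laplace_opD _ _ _ oD Dx Cg CkS).
  rewrite (laplace_opZ _ _ _ _ oD Dx CS) -[leRHS]addr0.
  by apply: lerD; [exact: gM|rewrite mulr_ge0_le0// LS].
Qed.

(** Compactness for the increasing family of open conditions obtained by
    allowing the first m balls only. *)
Lemma compact_finite_balls (R : realType) (n : nat)
    (K : set ('rV[R]_n.+1 * R)) (P : set ('rV[R]_n.+1 * R))
    (z : nat -> 'rV[R]_n.+1) (r : nat -> R) : compact K ->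
  (forall p, K p -> (exists k, `|p.1 - z k| < r k) \/ \forall q \near p, P q) ->
  exists m, forall p, K p -> \forall q \near p,
    (exists2 k, (k < m)%N & `|q.1 - z k| < r k) \/ P q.
Proof.
move=> /compact_near_coveringP nK cover.
pose Z m := [set q : 'rV[R]_n.+1 * R |
  (exists2 k, (k < m)%N & `|q.1 - z k| < r k) \/ P q].
have : \forall m \near \oo, K `<=` (fun p => nbhs p (Z m)).
  apply: (nK nat \oo (fun m p => nbhs p (Z m))) => p Kp.
  case: (cover p Kp) => [[k kp]|Pp].
    have op : nbhs p [set q : 'rV[R]_n.+1 * R | `|q.1 - z k| < r k].
      have ck : {for p, continuous (fun q : 'rV[R]_n.+1 * R => `|q.1 - z k|)}.
        by apply: cvg_norm; apply: cvgB; [exact: cvg_fst|exact: cvg_cst].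
      exact: cvgr_lt ck _ kp.
    exists ([set q | nbhs q [set q : 'rV[R]_n.+1 * R | `|q.1 - z k| < r k]],
            [set m | (k < m)%N]).
      by split=> /=; [exact: nbhs_interior|exact: nbhs_infty_gt].
    move=> [q m] [/= nq km]; apply: filterS nq => q' kq'.
    by left; exists k.
  exists ([set q | nbhs q P], setT).
    by split=> /=; [exact: nbhs_interior|exact: filterT].
  by move=> [q m] [/= nq _]; apply: filterS nq => q' Pq'; right.
by move=> [m _ mP]; exists m; apply: (mP m) => /=.
Qed.

Section CylinderTopology.
Context {R : realType} {n : nat}.
Local Notation V := 'rV[R]_n.+1.

Lemma closed_norm_le (z : V) (rho : R) : closed [set x | `|x - z| <= rho].
Proof.
have -> : [set x : V | `|x - z| <= rho] = (fun x => `|x - z|) @^-1` [set s | s <= rho].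
  by [].
apply: (preimage_closed _ (@closed_le _ _)) => x _.
exact: cvg_norm (cvgB cvg_id (cvg_cst z)).
Qed.

Lemma compact_cylinder (A : set V) (z : V) (rho ta tb : R) : closed A ->
  compact ((A `&` [set x | `|x - z| <= rho]) `*` [set t | ta <= t <= tb]).
Proof.
move=> clA; apply: compact_setX.
  apply: bounded_closed_compact; last first.
    by apply: closedI => //; exact: closed_norm_le.
  exists (rho + `|z|); split; first exact: num_real.
  move=> s rs x [_ /= xz]; apply: ltW; apply: le_lt_trans rs.
  rewrite -[x in `|x|](subrK z); apply: le_trans (ler_normD _ _) _.
  by rewrite lerD2r.
have -> : [set t | ta <= t <= tb] = `[ta, tb]%classic.
  by apply/seteqP; split => t /=; rewrite in_itv.
exact: segment_compact.
Qed.

End CylinderTopology.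

(** * The lower bound for the supersolution *)

Local Notation nearby Omega z0 rho := (Omega `&` [set x | `|x - z0| < rho]).

(** The conclusion does not contain the singular barriers any more: for a given
    (x1, t1) the cover of E is chosen so efficient that their contribution at
    x1 is below e/2. *)
Lemma lower_bound_by_regular_majorant (R : realType) (n : nat)
    (lam Lam T : R) (Omega : set 'rV[R]_n.+1)
    (b : 'rV[R]_n.+1 -> R -> 'rV[R]_n.+1) (c u : 'rV[R]_n.+1 -> R -> R) (L : R)
    (E : set 'rV[R]_n.+1) (z0 : 'rV[R]_n.+1) (mu : R)
    (h : 'rV[R]_n.+1 -> 'rV[R]_n.+1 -> R) (t0 tau beta M : R) :
  0 < lam -> lam < Lam -> open Omega ->
  (forall x t, cylinder Omega T (x, t) -> c x t <= 0) ->
  C21_on (cylinder Omega T) u -> 0 <= L ->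
  (forall x t, cylinder Omega T (x, t) -> - L <= u x t) ->
  (forall x t, cylinder Omega T (x, t) ->
    parabolic_op lam Lam b c u x t <= L) ->
  E `<=` boundary Omega -> E z0 -> 0 < mu -> (hausdorff_dim E < mu%:E)%E ->
  barrier_family (elliptic_op lam Lam b c) T Omega E (- mu) h ->
  0 < tau -> 0 < t0 - tau -> t0 + tau < T -> 0 <= beta ->
  L <= beta * (tau / 2) ^+ 2 -> L + 2 * beta * tau < M ->
  exists2 rho1 : R, 0 < rho1 & forall (rho : R) (W : 'rV[R]_n.+1 -> R),
    0 < rho -> rho <= rho1 ->
    (forall x t, (boundary Omega `\` E) x -> `|x - z0| <= rho ->
      `|t - t0| <= tau -> nonneg_at (cylinder Omega T) u (x, t)) ->
    {in nearby Omega z0 rho, continuous W} ->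
    touched_supersolution lam T b c (nearby Omega z0 rho) W M ->
    (forall x, nearby Omega z0 rho x -> 0 <= W x) ->
    (forall x, nearby Omega z0 rho x -> rho / 2 < `|x - z0| -> L <= W x) ->
    forall x t, nearby Omega z0 rho x -> t0 - tau < t <= t0 + tau ->
      0 <= u x t + W x + beta * (t - t0) ^+ 2.
Proof.
move=> lam0 lamLam oOmega c_le0 Cu L0 uL Lu EB Ez0 mu0 dimE Bh.
move=> tau0 taT tbT beta0 betaL LM.
have EO : E `<=` ~` Omega.
  move=> x /EB[_ nint] Ox; apply: nint.
  exact: open_nbhs_nbhs (conj oOmega Ox).
have [rho1 [gam [C [[rho10 gam0 C0] SP]]] ] :=
  singular_majorant lamLam oOmega z0 EO mu0 Bh.
exists rho1 => // rho W rho0 rhole bd cW TW W0 WL x1 t1 Dx1 t1b.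
set D := Omega `&` [set x | `|x - z0| < rho] in cW TW W0 WL Dx1.
apply/ler_addgt0Pr => /= e e0.
(* The singular barriers are controlled at x1 because x1 has a positive
   distance d to E, which lies outside the open set Omega. *)
have [d d0 dO] : exists2 d : R, 0 < d & forall y, E y -> d <= `|x1 - y|.
  have /nbhs_ballP[d /= d0 dO] := open_nbhs_nbhs (conj oOmega Dx1.1).
  exists d => // y Ey; rewrite leNgt; apply/negP => yd.
  by apply: (EO y Ey); apply: dO; rewrite -ball_normE.
pose k : R := L / gam.
have k0 : 0 <= k by rewrite divr_ge0// ltW.
pose N : R := k * (C * d `^ (- mu)) + 1.
have N0 : 0 < N by rewrite ltr_wpDl// mulr_ge0// mulr_ge0 ?powR_ge0// ltW.
have e2 : 0 < e / 2 by rewrite divr_gt0.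
have eN : 0 < e / 2 / N by rewrite divr_gt0.
have AE : E `&` [set x | `|x - z0| < rho] `<=` E by move=> x [].
have Az0 : (E `&` [set x | `|x - z0| < rho]) z0.
  by split=> //=; rewrite subrr normr0.
have [z [r [zP cover sum_le]]] := ball_cover mu0 dimE AE Az0 eN.
pose ta := t0 - tau; pose tb := t0 + tau.
pose Kb := ((closure Omega `&` ~` Omega) `&` [set x | `|x - z0| <= rho / 2])
  `*` [set t | ta <= t <= tb].
pose P := [set q : 'rV[R]_n.+1 * R |
  cylinder Omega T q -> - (e / 2) <= u q.1 q.2].
have cKb : compact Kb.
  apply: compact_cylinder; apply: closedI; first exact: closed_closure.
  exact: open_closedC.
have coverKb p : Kb p ->
    (exists k, `|p.1 - z k| < r k) \/ \forall q \near p, P q.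
  move=> [[[clp nOp] /= pz] /andP[pa pb]].
  have [Ep|nEp] := pselect (E p.1).
    by left; apply: cover; split=> //=; clear -pz rho0; lra.
  right; have : nonneg_at (cylinder Omega T) u (p.1, p.2).
    apply: bd; last 2 first.
    - by clear -pz rho0; lra.
    - rewrite ler_distlC; move: pa pb; rewrite /ta /tb; clear.
      by move=> ? ?; apply/andP; split; lra.
    by split=> //; split=> // /interior_subset.
  rewrite -surjective_pairing => /nonneg_atP; exact.
have [m mP] := compact_finite_balls cKb coverKb.
pose S x := \sum_(i < m) r i `^ mu * h (z i) x.
have zP' i : (E (z i) /\ `|z i - z0| < rho) /\ 0 < r i by exact: zP.
have [CS LS S0 Sgam Sd] := SP rho z r rhole zP' m.
have oD : open D by exact: open_nearby.
pose K := (closure Omega `&` [set x | `|x - z0| <= rho])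
  `*` [set t | ta <= t <= tb].
have cK : compact K by apply: compact_cylinder; exact: closed_closure.
have := comparison lam0 lamLam c_le0 Cu Lu.
move=> /(_ D K (fun x => W x + k * S x) t0 ta tb beta tau (e / 2) M oD).
have cWS : {in D, continuous (fun x => W x + k * S x)}.
  move=> x Dx.
  have ck : {for x, continuous (fun _ : 'rV[R]_n.+1 => k)}.
    exact: cst_continuous.
  have [cS _ _] := CS.
  exact: continuousD (cW x Dx) (continuousM ck (cS x Dx)).
have WS0 x : D x -> 0 <= W x + k * S x.
  by move=> Dx; rewrite addr_ge0 ?W0// mulr_ge0// S0.
have Gcyl q : (D `*` [set t | ta < t <= tb]) q -> cylinder Omega T q.
  move=> [[Oq _] /= /andP[qa qb]]; split=> //=; move: qa qb; rewrite /ta /tb.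
  by clear -taT tbT; lra.
have tauP t : ta < t <= tb -> `|t - t0| <= tau.
  move=> /andP[]; rewrite /ta /tb ler_norml; clear=> ? ?.
  by apply/andP; split; lra.
have TWS : touched_supersolution lam T b c D (fun x => W x + k * S x) M.
  exact: touched_supersolution_add oD k0 TW CS LS.
have GK : D `*` [set t | ta < t <= tb] `<=` K.
  move=> q [[Oq /ltW qz] /= /andP[/ltW qa qb]].
  by split=> /=; [split=> //; exact: subset_closure|rewrite qa qb].
move=> /(_ (fun _ => @proj1 _ _) cWS (ltW taT) tbT beta0 (ltW e2)
  tauP LM TWS cK GK) /= H.
have {}H : forall p, D p.1 /\ ta < p.2 <= tb ->
    0 <= u p.1 p.2 + (W p.1 + k * S p.1) + beta * (p.2 - t0) ^+ 2 + e / 2.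
  apply: H => p Kp nG.
  have v0 q : D q.1 /\ ta < q.2 <= tb ->
      L <= beta * (q.2 - t0) ^+ 2 \/ L <= W q.1 + k * S q.1 \/
      - (e / 2) <= u q.1 q.2 ->
    0 <= u q.1 q.2 + (W q.1 + k * S q.1) + beta * (q.2 - t0) ^+ 2 + e / 2.
    move=> Gq; have := WS0 q.1 Gq.1.
    have := mulr_ge0 beta0 (sqr_ge0 (q.2 - t0)).
    have : - L <= u q.1 q.2 by apply: uL; exact: Gcyl Gq.
    move: (u q.1 q.2) (W q.1 + _) (beta * _) => uq w bq V1 V2 V3.
    by clear -e0 V1 V2 V3; case=> [|[]] ?; lra.
  have [p_early|p_late] := ltP p.2 (t0 - tau / 2).
    have nq : \forall q \near p, q.2 < t0 - tau / 2.
      have cp : {for p, continuous (snd : 'rV[R]_n.+1 * R -> R)} by exact: cvg_snd.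
      exact: cvgr_lt cp _ p_early.
    apply: filterS nq => q qt Gq; apply: v0 => //; left.
    apply: le_trans betaL _; rewrite ler_wpM2l// -[leRHS]sqrrN.
    by rewrite lerXn2r ?nnegrE//; clear -qt tau0; lra.
  have [p_far|p_close] := ltP (rho / 2) `|p.1 - z0|.
    have nq : \forall q \near p, rho / 2 < `|q.1 - z0|.
      have cp : {for p, continuous (fun q : 'rV[R]_n.+1 * R => `|q.1 - z0|)}.
        by apply: cvg_norm; apply: cvgB; [exact: cvg_fst|exact: cvg_cst].
      exact: cvgr_gt cp _ p_far.
    apply: filterS nq => q qz Gq; apply: v0 => //; right; left.
    apply: le_trans (WL _ Gq.1 qz) _; rewrite lerDl mulr_ge0//.
    exact: S0 Gq.1.
  have Kbp : Kb p.
    have [[clp pz] /andP[pa pb]] := Kp.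
    split; last by rewrite /= pa pb.
    split=> //; split=> // Op; apply: nG; split.
      by split=> //=; clear -p_close rho0; lra.
    by rewrite /= pb andbT /ta; clear -p_late tau0; lra.
  apply: filterS (mP p Kbp) => q + Gq => -[[i im qi]|Pq]; apply: v0 => //.
    right; left; have := Sgam q.1 i Gq.1 im qi.
    move=> /(ler_wpM2l k0); rewrite {1}/k divfK ?gt_eqF// => LkS.
    by apply: le_trans LkS _; rewrite lerDr W0//; exact: Gq.1.
  by right; right; apply: Pq; exact: Gcyl.
have Gp1 : D x1 /\ ta < t1 <= tb by [].
have := H (x1, t1) Gp1; rewrite /=.
have kS : k * S x1 <= e / 2.
  have Sx1 : S x1 <= C * d `^ (- mu) * \sum_(i < m) r i `^ mu.
    by apply: Sd => // i; apply: dO; exact: (zP' i).1.1.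
  apply: le_trans (ler_wpM2l k0 Sx1) _.
  apply: (@le_trans _ _ (k * (C * d `^ (- mu) * (e / 2 / N)))).
    by rewrite ler_wpM2l// ler_wpM2l// mulr_ge0 ?powR_ge0// ltW.
  rewrite mulrA mulrCA -[leRHS]mulr1 ler_wpM2l ?(ltW e2)//.
  by rewrite ler_pdivrMr// mul1r /N lerDl.
move: (u x1 t1) (W x1) (beta * _) (k * S x1) kS => A1 A2 A3 A4.
by clear; lra.
Qed.

(** * The boundary inequality *)

Theorem theorem5p3 (R : realType) (n : nat) (lam Lam T K : R)
    (Omega : set 'rV[R]_n.+1)
    (b : 'rV[R]_n.+1 -> R -> 'rV[R]_n.+1) (c : 'rV[R]_n.+1 -> R -> R)
    (E : set 'rV[R]_n.+1) (z0 : 'rV[R]_n.+1) (mu eta : R)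
    (u : 'rV[R]_n.+1 -> R -> R) (L t0 : R) :
  0 < lam -> lam < Lam -> 0 < T -> 0 <= K ->
  open Omega ->
  (forall x t, cylinder Omega T (x, t) -> enorm (b x t) <= K) ->
  (forall x t, cylinder Omega T (x, t) -> c x t <= 0) ->
  E `<=` boundary Omega -> E z0 ->
  0 < mu -> 0 < eta ->
  (exists h, barrier_family (elliptic_op lam Lam b c) T Omega E (- mu) h) ->
  (exists h, barrier_family (elliptic_op lam Lam b c) T Omega [set z0] eta h) ->
  (hausdorff_dim E < mu%:E)%E ->
  C21_on (cylinder Omega T) u ->
  0 <= L ->
  (forall x t, cylinder Omega T (x, t) -> - L <= u x t) ->
  (forall x t, cylinder Omega T (x, t) ->
     parabolic_op lam Lam b c u x t <= L) ->
  0 < t0 < T ->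
  nonneg_on_near (cylinder Omega T)
    ((boundary Omega `\` E) `*` [set t | 0 < t < T]) u (z0, t0) ->
  nonneg_at (cylinder Omega T) u (z0, t0).
Proof.
move=> lam0 lamLam _ _ oOmega _ c_le0 EB Ez0 mu0 eta0 [hs Bs] [hr Br] dimE Cu
  L0 uL Lu /andP[t00 t0T] /nbhs_ballP[/= dl dl0 bd].
have z0O : ~ Omega z0.
  by move=> Oz; apply: (EB _ Ez0).2; exact: open_nbhs_nbhs (conj oOmega Oz).
(* beta is fixed by beta (tau/2)^2 = L, so that the time term dominates L in
   the lower quarter of the cylinder. *)
pose tau : R := Num.min (Num.min t0 (T - t0)) dl / 2.
have m0 : 0 < Num.min (Num.min t0 (T - t0)) dl.
  by rewrite !lt_min t00 dl0 subr_gt0 t0T.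
have tau0 : 0 < tau by rewrite divr_gt0.
have : tau < Num.min (Num.min t0 (T - t0)) dl.
  by rewrite /tau; clear -m0; lra.
rewrite !lt_min => /andP[/andP[tau_t0 tau_T] tau_dl].
pose beta : R := 4 * L / tau ^+ 2.
have beta0 : 0 <= beta by rewrite /beta divr_ge0 ?sqr_ge0// mulr_ge0.
have betaL : L <= beta * (tau / 2) ^+ 2.
  by rewrite le_eqVlt; apply/orP; left; apply/eqP; rewrite /beta; field;
     rewrite gt_eqF.
pose M : R := L + 2 * beta * tau + 1.
have M0 : 0 <= M.
  by rewrite addr_ge0// addr_ge0// mulr_ge0 ?(ltW tau0)// mulr_ge0.
have LM : L + 2 * beta * tau < M by rewrite ltrDl.
have [rho2 rho20 RW] := regular_majorant lamLam oOmega z0O eta0 Br.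
have taT : 0 < t0 - tau by rewrite subr_gt0.
have tbT : t0 + tau < T by rewrite -ltrBrDl.
have [rho1 rho10 bound] := lower_bound_by_regular_majorant lam0 lamLam oOmega
  c_le0 Cu L0 uL Lu EB Ez0 mu0 dimE Bs tau0 taT tbT beta0 betaL LM.
pose rho : R := Num.min (Num.min rho1 rho2) (dl / 2).
have rho0 : 0 < rho by rewrite !lt_min rho10 rho20 divr_gt0.
have [rho_1 rho_2 rho_dl] : [/\ rho <= rho1, rho <= rho2 & rho < dl].
  split; rewrite /rho; first by rewrite !ge_min lexx.
    by rewrite !ge_min lexx orbT.
  by rewrite gt_min; apply/orP; right; clear -dl0; lra.
have [W [cW TW W0 WL Wsmall]] := RW rho M L rho0 rho_2 M0 L0.
have {}bd x t : (boundary Omega `\` E) x -> `|x - z0| <= rho ->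
    `|t - t0| <= tau -> nonneg_at (cylinder Omega T) u (x, t).
  move=> Bx xz tt; apply: bd.
    split; rewrite -ball_normE /ball_ /= distrC.
      exact: le_lt_trans xz rho_dl.
    exact: le_lt_trans tt tau_dl.
  split=> //=; move: tt; rewrite ler_distl => /andP[lo hi].
  by apply/andP; split; [exact: lt_le_trans taT lo|exact: le_lt_trans hi tbT].
have {}bound := bound rho W rho0 rho_1 bd cW TW W0 WL.
apply/nonneg_atP => eps eps0.
have e2 : 0 < eps / 2 by rewrite divr_gt0.
have [d d0 Wd] := Wsmall _ e2.
pose s : R := Num.min (Num.min 1 tau) (eps / 2 / (beta + 1)).
have b1 : 0 < beta + 1 by rewrite ltr_wpDl.
have s0 : 0 < s by rewrite !lt_min ltr01 tau0 divr_gt0.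
pose a : R := Num.min (Num.min rho d) s.
have a0 : 0 < a by rewrite /a lt_min s0 andbT lt_min rho0.
apply/nbhs_ballP; exists a => //= -[x t] [/= + +] [Ox _].
rewrite -!ball_normE /ball_ /= ![`|z0 - _|]distrC ![`|t0 - _|]distrC.
rewrite {1}/a lt_min lt_min => /andP[/andP[xrho xd] _].
rewrite /a lt_min => /andP[_]; rewrite /s lt_min lt_min.
move=> /andP[/andP[t1 tt] tb].
have Dx : (Omega `&` [set x | `|x - z0| < rho]) x by split.
have tb2 : beta * (t - t0) ^+ 2 <= eps / 2.
  rewrite -real_normK ?num_real// expr2 mulrA.
  apply: (@le_trans _ _ ((beta + 1) * `|t - t0|)).
    apply: ler_pM => //; first by rewrite mulr_ge0.
    rewrite -[leRHS]mulr1; apply: ler_pM => //; last exact: ltW.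
    by rewrite lerDl.
  by rewrite mulrC -ler_pdivlMr// ltW.
have := bound x t Dx; have := Wd x Dx xd.
have -> : t0 - tau < t <= t0 + tau.
  by move: tt; rewrite ltr_norml => /andP[]; clear => ? ?;
    apply/andP; split; lra.
move: tb2; move: (u x t) (W x) (beta * _) => A1 A2 A3 H1 H2 /(_ isT).
by move: H1 H2; clear; lra.
Qed.
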